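(* Let $\mu_n$ ($n\in\mathbb{N}$) and $\mu$ be equi-translation bounded measures on $\mathbb{R}^d$, and let $\mathcal{A}=(A_m)_{m\in\mathbb{N}}$ be a fixed van Hove sequence. Assume that the autocorrelations $\gamma_n=\mu_n\circledast\widetilde{\mu_n}$ and $\gamma=\mu\circledast\widetilde{\mu}$ exist along $\mathcal{A}$ for all $n\in\mathbb{N}$, and that also the Eberlein convolutions $\mu_n\circledast\mu$ exist. If $\mu_n\rightsquigarrow\mu$ (mean convergence) as $n\to\infty$, then $\gamma_n\xrightarrow{\pi}\gamma$ (convergence in the product topology). In particular, one then has $\lim_{n\to\infty}\gamma_n=\gamma$ in the vague topology.
   Context: Measures are (complex) Radon measures on $\mathbb{R}^d$. $C_{\mathsf c}(\mathbb{R}^d)$ is the space of continuous functions with compact support. For a measure $\nu$ and a compact $K$ that is the closure of its nonempty interior, $\|\nu\|_K=\sup_{t\in\mathbb{R}^d}|\nu|(t+K)$; $\nu$ is translation bounded if this is finite, and a family of measures is equi-translation bounded if $\|\cdot\|_K$ is uniformly bounded on it. For a function $g$, $\widetilde g(x)=\overline{g(-x)}$, and $\widetilde\nu(g)=\overline{\nu(\widetilde g)}$. Van Hove sequence: compact sets $A_m\subset A_{m+1}\subset\mathbb{R}^d$ with $\operatorname{vol}(\partial^KA_m)=o(\operatorname{vol}(A_m))$ as $m\to\infty$ for every compact $K\subset\mathbb{R}^d$, where $\partial^KA=(\overline{A+K}\setminus A^\circ)\cup((\overline{\mathbb{R}^d\setminus A}-K)\cap A)$. Eberlein convolution along $\mathcal{A}$: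 $\nu\circledast\nu'=\lim_{m\to\infty}\frac{1}{\operatorname{vol}(A_m)}\,\nu|_{A_m}*\nu'|_{A_m}$ (vague limit, if it exists), where $\nu|_{A}$ is the restriction of $\nu$ to $A$; for an autocorrelation, $\nu\circledast\widetilde\nu=\lim_{m\to\infty}\frac{1}{\operatorname{vol}(A_m)}\,\nu|_{A_m}*\widetilde{\nu|_{A_m}}$. Upper absolute mean of a bounded uniformly continuous function: $\overline M(f)=\limsup_{m\to\infty}\frac{1}{\operatorname{vol}(A_m)}\int_{A_m}|f(x)|\,dx$. Mean convergence $\mu_n\rightsquigarrow\mu$ means $\overline M((\mu_n-\mu)*g)\to0$ as $n\to\infty$ for every $g\in C_{\mathsf c}(\mathbb{R}^d)$. Product topology convergence $\mu_n\xrightarrow{\pi}\mu$ means $\|(\mu_n-\mu)*g\|_\infty\to0$ for every $g\in C_{\mathsf c}(\mathbb{R}^d)$. Vague convergence means $\mu_n(g)\to\mu(g)$ for every $g\in C_{\mathsf c}(\mathbb{R}^d)$. *)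

(* Defs.v *)
From HB Require Import structures.
From mathcomp Require Import all_boot all_order all_algebra.
From mathcomp Require Import complex.
From mathcomp Require Import all_classical all_reals all_analysis.
From mathcomp Require Import measurable_realfun.
Set Implicit Arguments. Unset Strict Implicit. Unset Printing Implicit Defensive.
Import Order.TTheory GRing.Theory Num.Theory.
Import numFieldNormedType.Exports.
Local Open Scope classical_set_scope.
Local Open Scope ring_scope.

(* R^d with its Borel sigma-algebra; as a bare type this is 'rV[R]_d, whose
   norm is the sup norm. *)
Notation Rd R d := (g_sigma_algebraType (@open 'rV[R]_d)).

Section lebesgue_measure_Rd.
Variable R : realType.

Definition row_cons d (p : measurableTypeR R * Rd R d) : Rd R d.+1 :=
  row_mx (p.1%:M : 'M[R]_1) p.2.

(* d-dimensional Lebesgue measure, by recursion on R^(d+1) = R x R^d *)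
Fixpoint lebesgue_Rd d : set (Rd R d) -> \bar R :=
  match d with
  | 0 => @dirac _ (Rd R 0) (0 : 'rV[R]_0) R
  | d'.+1 => pushforward (@lebesgue_measure R \x @lebesgue_Rd d')%E (@row_cons d')
  end.

Definition box d (a b : 'rV[R]_d) : set 'rV[R]_d :=
  [set v | forall i, a ord0 i <= v ord0 i <= b ord0 i].

Lemma row_cons0 d p : @row_cons d p ord0 ord0 = p.1.
Proof.
have := @row_mxEl _ 1 1 d p.1%:M p.2 ord0 ord0.
rewrite [RHS]mxE eqxx mulr1n => <-.
by congr (row_mx _ _ _ _); exact: val_inj.
Qed.

Lemma row_consS d p i : @row_cons d p ord0 (lift ord0 i) = p.2 ord0 i.
Proof.
rewrite -(@row_mxEr _ 1 1 d p.1%:M).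
by congr (row_mx _ _ _ _); exact: val_inj.
Qed.

Lemma measurable_row_cons d : measurable_fun setT (@row_cons d).
Proof.
apply: (@measurability _ _ _ (Rd R d.+1) setT (@row_cons d) (@open 'rV[R]_d.+1)) => //.
move=> _ [U oU <-]; rewrite setTI.
pose B (i : rat * 'rV[rat]_d * rat) : set (measurableTypeR R * Rd R d) :=
  ball (ratr i.1.1 : R) (ratr i.2) `*`
  ball (map_mx ratr i.1.2 : 'rV[R]_d) (ratr i.2).
have -> : @row_cons d @^-1` U =
    \bigcup_i (if pselect (B i `<=` @row_cons d @^-1` U) then B i else set0).
  apply/seteqP; split => [p /= Up|p [i _]]; last first.
    by case: pselect => // BU /BU.
  have /nbhs_ballP[e /= e0 eU] := open_nbhs_nbhs (conj oU Up).
  have /rat_in_itvoo[r] : 0 < e / 2 by rewrite divr_gt0.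
  rewrite in_itv/= => /andP[r0 re].
  have apx (x : R) : exists q : rat, `|ratr q - x| < ratr r.
    have /rat_in_itvoo[q] : x - ratr r < x + ratr r.
      by rewrite ltrBlDr -addrA ltrDl addr_gt0.
    by rewrite in_itv/= => /andP[q1 q2]; exists q; rewrite ltr_distl q1 q2.
  have [q hq] := apx p.1.
  pose w : 'rV[rat]_d := \row_j projT1 (cid (apx (p.2 ord0 j))).
  have Bp : B (q, w, r) p.
    split => //=; split => // i j; rewrite !mxE.
    by rewrite (ord1 i) /ball/=; case: cid.
  exists (q, w, r) => //; case: pselect => // -[]; move: Bp => [/= Bp1 [_ Bp2]].
  move=> p' [/= B1 [_ B2]]; apply: eU; split => // i j; rewrite (ord1 i).
  have [k ->|->] := unliftP ord0 j; rewrite ?row_cons0 ?row_consS.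
    rewrite (splitr e).
    apply: (@ball_triangle _ _ ((map_mx ratr w : 'rV[R]_d) ord0 k)).
      by apply: ball_sym; apply: le_ball (Bp2 _ _); exact: ltW.
    by apply: le_ball (B2 _ _); exact: ltW.
  rewrite (splitr e); apply: (@ball_triangle R R (ratr q)).
    by apply: ball_sym; apply: le_ball Bp1; exact: ltW.
  by apply: le_ball B1; exact: ltW.
apply: countable_bigcupT_measurable => [|i]; first exact: countableP.
case: pselect => ?; last exact: measurable0.
apply: measurableX; first exact: measurable_ball.
by apply: sub_sigma_algebra; exact: (@ball_open R 'rV[R]_d).
Qed.

Lemma measurable_box d (a b : 'rV[R]_d) : measurable (box a b : set (Rd R d)).
Proof.
rewrite -[box a b]setCK; apply: measurableC; apply: sub_sigma_algebra => /=.
apply: closed_openC.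
have -> : box a b = \bigcap_(i in [set: 'I_d])
    ((fun v : 'rV[R]_d => v ord0 i) @^-1` `[a ord0 i, b ord0 i]).
  by apply/seteqP; split => v /= h i; have := h i;
     rewrite /= in_itv /=; [move=> /[swap] _|move=> /(_ Logic.I)].
apply: closed_bigI => i _; apply: closed_comp; last exact: interval_closed.
by move=> v _; exact: coord_continuous.
Qed.

Let box_cover d :
  \bigcup_n box (const_mx (- n%:R)) (const_mx n%:R) = [set: 'rV[R]_d].
Proof.
apply/seteqP; split => // v _; exists (Num.truncn `|v|).+1 => // i.
rewrite !mxE -ler_norml; apply: le_trans (ltW (truncnS_gt _)).
rewrite [leRHS]/Num.Def.normr /= mx_normrE; apply/bigmax_geP; right => /=.
by exists (ord0, i).
Qed.

Section step.
Variables (d : nat) (m : {sigma_finite_measure set (Rd R d) -> \bar R}).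
Hypothesis mE : forall a b : 'rV[R]_d, (forall i, a ord0 i <= b ord0 i) ->
  m (box a b) = (\prod_(i < d) (b ord0 i - a ord0 i))%:E.

Definition lebesgue_Rd_step : set (Rd R d.+1) -> \bar R :=
  pushforward (@lebesgue_measure R \x m)%E (@row_cons d).

Lemma lebesgue_Rd_step_box (a b : 'rV[R]_d.+1) : (forall i, a ord0 i <= b ord0 i) ->
  lebesgue_Rd_step (box a b) = (\prod_(i < d.+1) (b ord0 i - a ord0 i))%:E.
Proof.
move=> ab; rewrite /lebesgue_Rd_step /pushforward.
have -> : @row_cons d @^-1` box a b = `[a ord0 ord0, b ord0 ord0] `*`
    box (\row_i a ord0 (lift ord0 i)) (\row_i b ord0 (lift ord0 i)).
  apply/seteqP; split => [p /= h|p /= [h1 h2] i].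
    split; first by have := h ord0; rewrite row_cons0 in_itv.
    by move=> i; rewrite !mxE; have := h (lift ord0 i); rewrite row_consS.
  have [k ->|->] := unliftP ord0 i.
    by rewrite row_consS; have := h2 k; rewrite !mxE.
  by rewrite row_cons0; move: h1; rewrite in_itv.
rewrite product_measure1E//; last exact: measurable_box.
rewrite mE => [|i]; last by rewrite !mxE.
rewrite /= lebesgue_measure_itv/= lte_fin big_ord_recl EFinM; congr (_ * _)%E.
  case: ltP => // ba; congr EFin; apply/esym/eqP.
  by rewrite subr_eq0 eq_le ba; exact: ab.
by congr EFin; apply: eq_bigr => i _; rewrite !mxE.
Qed.

Let step0 : lebesgue_Rd_step set0 = 0%E.
Proof. by rewrite /lebesgue_Rd_step /pushforward preimage_set0 measure0. Qed.

Let step_ge0 A : (0 <= lebesgue_Rd_step A)%E.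
Proof. by rewrite /lebesgue_Rd_step /pushforward; exact: measure_ge0. Qed.

Let step_sigma_additive : semi_sigma_additive lebesgue_Rd_step.
Proof.
have mp A : measurable A -> measurable (@row_cons d @^-1` A).
  by move=> mA; rewrite -[X in measurable X]setTI; exact: measurable_row_cons.
move=> F mF tF mUF; rewrite /lebesgue_Rd_step /pushforward preimage_bigcup.
apply: measure_semi_sigma_additive => [n||].
- exact: mp.
- apply/trivIsetP => /= i j _ _ ij; rewrite -preimage_setI.
  by move/trivIsetP : tF => /(_ _ _ _ _ ij) ->//; rewrite preimage_set0.
- by rewrite -preimage_bigcup; exact: mp.
Qed.

HB.instance Definition _ := isMeasure.Build _ _ _ lebesgue_Rd_step
  step0 step_ge0 step_sigma_additive.

Let step_sigma_finite : sigma_finite setT lebesgue_Rd_step.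
Proof.
exists (fun n => box (const_mx (- n%:R)) (const_mx n%:R)).
  by rewrite box_cover.
move=> n; split; first exact: measurable_box.
rewrite lebesgue_Rd_step_box ?ltry// => i.
by rewrite !mxE (le_trans (y := 0))// oppr_le0.
Qed.

HB.instance Definition _ := Measure_isSigmaFinite.Build _ _ _ lebesgue_Rd_step
  step_sigma_finite.

End step.

Let leb_spec d : exists m : {sigma_finite_measure set (Rd R d) -> \bar R},
  (m : set (Rd R d) -> \bar R) = @lebesgue_Rd d /\
  forall a b : 'rV[R]_d, (forall i, a ord0 i <= b ord0 i) ->
    m (box a b) = (\prod_(i < d) (b ord0 i - a ord0 i))%:E.
Proof.
elim: d => [|d [m [mE IH]]].
  exists (@dirac _ (Rd R 0) (0 : 'rV[R]_0) R); split => // a b _.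
  by rewrite big_ord0 /= diracE mem_set// => -[].
exists (lebesgue_Rd_step m); split; first by rewrite /= /lebesgue_Rd_step mE.
exact: (lebesgue_Rd_step_box IH).
Unshelve. exact: IH.
Qed.

Lemma lebesgue_Rd_box d (a b : 'rV[R]_d) : (forall i, a ord0 i <= b ord0 i) ->
  lebesgue_Rd (box a b : set (Rd R d)) = (\prod_(i < d) (b ord0 i - a ord0 i))%:E.
Proof. by have [m [<- mE]] := leb_spec d; exact: mE. Qed.

Let leb0 d : @lebesgue_Rd d set0 = 0%E.
Proof. by have [m [<- _]] := leb_spec d; exact: measure0. Qed.

Let leb_ge0 d A : (0 <= @lebesgue_Rd d A)%E.
Proof. by have [m [<- _]] := leb_spec d; exact: measure_ge0. Qed.

Let leb_sigma_additive d : semi_sigma_additive (@lebesgue_Rd d).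
Proof. by have [m [<- _]] := leb_spec d; exact: measure_semi_sigma_additive. Qed.

HB.instance Definition _ d := isMeasure.Build _ _ _ (@lebesgue_Rd d)
  (@leb0 d) (@leb_ge0 d) (@leb_sigma_additive d).

Let leb_sigma_finite d : sigma_finite setT (@lebesgue_Rd d).
Proof. by have [m [<- _]] := leb_spec d; exact: sigma_finiteT. Qed.

HB.instance Definition _ d := Measure_isSigmaFinite.Build _ _ _ (@lebesgue_Rd d)
  (@leb_sigma_finite d).

End lebesgue_measure_Rd.

Section complex_Radon_measures.
Variables (R : realType) (d : nat).

Local Notation Rd := (Rd R d).
(* the complex numbers with their usual topology *)
Local Notation C := (R[i]^o).
Local Notation vol := (@lebesgue_Rd R d).

Implicit Types (g : 'rV[R]_d -> C) (A K : set 'rV[R]_d).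

(* A complex Radon measure nu = nu_0 + i nu_1 - nu_2 - i nu_3, with nu_k a
   positive Radon measure: on R^d these are the locally finite Borel measures.
   The nu_k are not required to be the Jordan parts, so different records may
   represent the same nu; all notions below depend on nu only. *)
Record radon := Radon {
  radon_part : 'I_4 -> {measure set Rd -> \bar R} ;
  radon_locally_finite : forall k K, compact K -> (radon_part k K < +oo)%E }.

Implicit Types nu : radon.

Definition complex_integral (m : {measure set Rd -> \bar R}) A g : C :=
  ((\int[m]_(x in A) complex.Re (g x)) +i*
   (\int[m]_(x in A) complex.Im (g x)))%C.

Definition Cc g := continuous g /\ compact (closure [set x | g x != 0]).

(* Measures are also seen as functionals g |-> nu(g); these are only meaningful
   on integrable functions, e.g. those of Cc. *)
Local Notation functional := (('rV[R]_d -> C) -> C).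

(* g |-> nu|_A (g), i.e. the integral of g over A with respect to nu *)
Definition restriction nu A : functional := fun g =>
  \sum_(k < 4) 'i%C ^+ k * complex_integral (radon_part nu k) A g.

Definition radon_functional nu : functional := restriction nu setT.
Coercion radon_functional : radon >-> Funclass.

Definition tilde_fun g : 'rV[R]_d -> C := fun x => conjc (g (- x)).

Definition tilde (L : functional) : functional := fun g => conjc (L (tilde_fun g)).

Definition convolution (L L' : functional) : functional := fun g =>
  L (fun x => L' (fun y => g (x + y))).

Definition convolution_fun (L : functional) g : 'rV[R]_d -> C := fun x =>
  L (fun y => g (x - y)).

(* nu(B), for a bounded Borel set B *)
Definition radon_value nu (B : set Rd) : C :=
  \sum_(k < 4) 'i%C ^+ k * (fine (radon_part nu k B))%:C%C.

(* |nu|(B), for a bounded Borel set B *)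
Definition total_variation nu (B : set Rd) : \bar R :=
  ereal_sup [set s | exists n (F : 'I_n -> set Rd),
    [/\ forall i, measurable (F i), trivIset setT F, \bigcup_i F i = B &
        s = (\sum_(i < n) Normc.normc (radon_value nu (F i)))%:E]].

Definition norm_on K nu : \bar R :=
  ereal_sup [set total_variation nu [set t + x | x in K] | t in [set: 'rV[R]_d]].

(* The choice of K is immaterial: any two of these norms are equivalent. *)
Definition equi_translation_bounded (F : set radon) :=
  exists K, [/\ compact K, K = closure K°, K° !=set0 &
    exists M : R, forall nu, F nu -> (norm_on K nu <= M%:E)%E].

Definition vague_cvg (L : nat -> functional) (L' : functional) :=
  forall g, Cc g -> L n g @[n --> \oo] --> L' g.

Definition van_Hove_boundary K A : set 'rV[R]_d :=
  (closure [set a + k | a in A & k in K] `\` A°) `|`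
  ([set b - k | b in closure (~` A) & k in K] `&` A).

Definition van_Hove (A : nat -> set 'rV[R]_d) :=
  [/\ forall m, compact (A m), forall m, A m `<=` A m.+1 &
      forall K, compact K ->
        (fun m => fine (vol (van_Hove_boundary K (A m)))) =o_\oo
        (fun m => fine (vol (A m)))].

Definition normalized (A : set 'rV[R]_d) (L : functional) : functional :=
  fun g => ((fine (vol A))^-1)%:C%C * L g.

Definition is_Eberlein_convolution (A : nat -> set 'rV[R]_d) nu nu' (rho : radon) :=
  vague_cvg (fun m => normalized (A m)
    (convolution (restriction nu (A m)) (restriction nu' (A m)))) rho.

Definition is_autocorrelation (A : nat -> set 'rV[R]_d) nu (gamma : radon) :=
  vague_cvg (fun m => normalized (A m)
    (convolution (restriction nu (A m)) (tilde (restriction nu (A m))))) gamma.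

Definition upper_mean (A : nat -> set 'rV[R]_d) g : \bar R :=
  limn_esup (fun m => ((fine (vol (A m)))^-1)%:E *
                      \int[vol]_(x in A m) (Normc.normc (g x))%:E)%E.

Definition sup_norm g : \bar R :=
  ereal_sup [set (Normc.normc (g x))%:E | x in [set: 'rV[R]_d]].

Definition mean_cvg (A : nat -> set 'rV[R]_d) (mun : nat -> radon) (mu : radon) :=
  forall g, Cc g ->
    upper_mean A (convolution_fun (fun f => mun n f - mu f) g)
      @[n --> \oo] --> 0%E.

Definition product_cvg (mun : nat -> radon) (mu : radon) :=
  forall g, Cc g ->
    sup_norm (convolution_fun (fun f => mun n f - mu f) g)
      @[n --> \oo] --> 0%E.

End complex_Radon_measures.

(* Main.v *)
Require Import Defs.
From HB Require Import structures.
From mathcomp Require Import all_boot all_order all_algebra.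
From mathcomp Require Import complex.
From mathcomp Require Import all_classical all_reals all_analysis.
From mathcomp Require Import measurable_realfun.
From mathcomp Require Import ring lra.
Set Implicit Arguments. Unset Strict Implicit. Unset Printing Implicit Defensive.
Import Order.TTheory GRing.Theory Num.Theory.
Import numFieldNormedType.Exports.
Import Normc.
Local Open Scope classical_set_scope.
Local Open Scope ring_scope.

(** Fix [A = A_m] and put [nu = mu_n - mu]. Tested against [y |-> g (x - y)], an
    autocorrelation before the limit is the double integral of [g (x - (s - t))]
    against [mu|_A (ds)] and the conjugate of [mu|_A (dt)]. By bilinearity the
    difference of the autocorrelations of [mu_n] and [mu] is a sum of two such
    double integrals in which one of the two measures is [nu|_A] or its
    conjugate. Integrating that one first turns each of them into an integral of
    [t |-> (nu|_A * g) (x + t)] against a translation bounded measure [sigma], or,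
    up to conjugation, of the same function for [tilde g] and [- x].

    Mean convergence controls [nu * g] in Lebesgue mean, whereas [sigma] may well
    be singular. The bridge is smearing ([smear]): replace the integrand at
    [x + t] by its average over the cube of half-side [delta] around [x + t].
    After Fubini, the averaged integral is a Lebesgue integral of [nu|_A * g]
    against the [sigma]-mass of the part of [A] in the cube of half-side [delta]
    around [w - x], and this weight is bounded because [sigma] is translation
    bounded. The error is small for small [delta], uniformly in [n], [m] and [x]:
    the functions [nu|_A * g] are equi-uniformly continuous ([conv_unif]) and
    [sigma] gives [A] a mass of order [vol (A + cube)] ([local_bound_vol], which is
    smearing again). Altogether this
    is [pairing_estimate]. The Lebesgue integral that it produces runs over all
    points where [nu|_A * g] lives, so the translation by [x] leaves no trace in
    the bound; this is why the limit is uniform in [x], that is, holds in the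
    product topology and not just vaguely.

    Finally [nu|_A * g] coincides with [nu * g] on [A] off the van Hove boundary,
    vanishes outside [A] off that boundary, and is bounded ([integral_conv_le]).
    Dividing by [vol A_m] and letting [m] tend to infinity removes the boundary
    terms; what remains is a constant depending on [delta] times the upper means
    of [nu * g] and [nu * tilde g], plus a term that is small with [delta]. So one
    chooses [delta] first and [n] afterwards ([autocorr_diff_small]). Vague
    convergence is the case [x = 0] for the reflected [g].

    All estimates take place on compact sets. There a Radon measure is a finite
    complex combination of finite positive measures ([fcm]), for which linearity
    and Fubini are elementary; the total variation enters once, through the local
    bound of [total_variation_bound]. *)

(** * The modulus of a complex number *)

Section modulus.
Variable R : realType.
Implicit Types z w : R[i].

Lemma normc_norm z : `|z| = (normc z)%:C%C.
Proof. by case: z. Qed.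

Lemma normc_ge0 z : 0 <= normc z.
Proof. by case: z => a b; exact: sqrtr_ge0. Qed.

Lemma le_normcB z w : normc (z - w) <= normc z + normc w.
Proof. by rewrite -(normcN w); exact: le_normcD. Qed.

Lemma normcJ z : normc (conjc z) = normc z.
Proof. by case: z => a b /=; rewrite sqrrN. Qed.

Lemma normc_real (x : R) : normc x%:C%C = `|x|.
Proof. by rewrite /normc /= expr0n/= addr0 sqrtr_sqr. Qed.

Lemma normc_sum (I : Type) (s : seq I) (P : pred I) (F : I -> R[i]) :
  normc (\sum_(i <- s | P i) F i) <= \sum_(i <- s | P i) normc (F i).
Proof.
elim/big_rec2 : _ => [|i x y _ h]; first by rewrite normc0.
by rewrite (le_trans (le_normcD _ _))// lerD2l.
Qed.

Lemma Re_le_normc z : `|complex.Re z| <= normc z.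
Proof.
case: z => a b /=; rewrite -sqrtr_sqr ler_wsqrtr// lerDl; exact: sqr_ge0.
Qed.

Lemma Im_le_normc z : `|complex.Im z| <= normc z.
Proof.
case: z => a b /=; rewrite -(sqrtr_sqr b) ler_wsqrtr// lerDr; exact: sqr_ge0.
Qed.

Lemma normc_le_ReIm z : normc z <= `|complex.Re z| + `|complex.Im z|.
Proof.
case: z => a b /=.
rewrite -[leRHS]ger0_norm ?addr_ge0// -sqrtr_sqr ler_wsqrtr//.
have ha := normr_ge0 a; have hb := normr_ge0 b.
rewrite -(real_normK (num_real a)) -(real_normK (num_real b)); nra.
Qed.

End modulus.

(** * Bounded measurable complex functions and their integrals *)

Section bounded_measurable.
Context {dT} {T : measurableType dT} {R : realType}.
Implicit Types f g : T -> R[i].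

(** Every function integrated below lies in this class. It is stable under all
    the operations used, including partial integration, so that integrability
    against finite measures never has to be discussed again. *)
Definition cbm f := [/\ measurable_fun setT (fun x => complex.Re (f x)),
  measurable_fun setT (fun x => complex.Im (f x)) &
  exists M : R, forall x, normc (f x) <= M].

Lemma cbm_cst (z : R[i]) : cbm (fun=> z).
Proof. by split; [exact: measurable_cst|exact: measurable_cst|exists (normc z)]. Qed.

Lemma cbmD f g : cbm f -> cbm g -> cbm (fun x => f x + g x).
Proof.
move=> [f1 f2 [M fM]] [g1 g2 [N gN]]; split.
- rewrite [X in measurable_fun _ X](_ : _ =
    (fun x => complex.Re (f x)) \+ (fun x => complex.Re (g x))).
    exact: measurable_funD.
  by apply/funext => x /=; case: (f x); case: (g x).
- rewrite [X in measurable_fun _ X](_ : _ =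
    (fun x => complex.Im (f x)) \+ (fun x => complex.Im (g x))).
    exact: measurable_funD.
  by apply/funext => x /=; case: (f x); case: (g x).
- exists (M + N) => x; rewrite (le_trans (le_normcD _ _))//.
  by rewrite lerD.
Qed.

Lemma cbmM f g : cbm f -> cbm g -> cbm (fun x => f x * g x).
Proof.
move=> [f1 f2 [M fM]] [g1 g2 [N gN]]; split.
- rewrite [X in measurable_fun _ X](_ : _ =
    ((fun x => complex.Re (f x)) \* (fun x => complex.Re (g x))) \-
    ((fun x => complex.Im (f x)) \* (fun x => complex.Im (g x)))).
    by apply: measurable_funB; apply: measurable_funM.
  by apply/funext => x /=; case: (f x); case: (g x).
- rewrite [X in measurable_fun _ X](_ : _ =
    ((fun x => complex.Re (f x)) \* (fun x => complex.Im (g x))) \+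
    ((fun x => complex.Im (f x)) \* (fun x => complex.Re (g x)))).
    by apply: measurable_funD; apply: measurable_funM.
  by apply/funext => x /=; case: (f x); case: (g x).
- exists (M * N) => x; rewrite normcM ler_pM// ?normc_ge0//.
Qed.

Lemma cbmZ z f : cbm f -> cbm (fun x => z * f x).
Proof. by move=> hf; apply: cbmM => //; exact: cbm_cst. Qed.

Lemma cbmB f g : cbm f -> cbm g -> cbm (fun x => f x - g x).
Proof.
move=> hf hg; under eq_fun do rewrite -mulN1r.
by apply: cbmD => //; exact: cbmZ.
Qed.

Lemma cbmJ f : cbm f -> cbm (fun x => conjc (f x)).
Proof.
move=> [f1 f2 [M fM]]; split.
- rewrite [X in measurable_fun _ X](_ : _ = (fun x => complex.Re (f x)))//.
  by apply/funext => x /=; case: (f x).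
- rewrite [X in measurable_fun _ X](_ : _ = \- (fun x => complex.Im (f x))).
    exact: measurableT_comp.
  by apply/funext => x /=; case: (f x).
- by exists M => x; rewrite normcJ.
Qed.

Lemma cbm_sum (I : Type) (s : seq I) (F : I -> T -> R[i]) :
  (forall i, cbm (F i)) -> cbm (fun x => \sum_(i <- s) F i x).
Proof.
move=> hF; elim: s => [|i s ih].
  by under eq_fun do rewrite big_nil; exact: cbm_cst.
by under eq_fun do rewrite big_cons; exact: cbmD.
Qed.

Lemma cbm_real (f : T -> R) : measurable_fun setT f ->
  (exists M : R, forall x, `|f x| <= M) -> cbm (fun x => (f x)%:C%C).
Proof.
move=> mf [M fM]; split; [exact: mf|exact: measurable_cst|].
by exists M => x; rewrite normc_real.
Qed.

Lemma cbm_indic (B : set T) : measurable B -> cbm (fun x => (\1_B x)%:C%C).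
Proof.
move=> mB; apply: cbm_real; first exact: measurable_indic.
by exists 1 => x; rewrite indicE; case: (_ \in _); rewrite ?normr1 ?normr0.
Qed.

Lemma cbm_measurable_normc f : cbm f -> measurable_fun setT (fun x => normc (f x)).
Proof.
move=> [f1 f2 _].
rewrite [X in measurable_fun _ X](_ : _ = (fun x =>
  Num.sqrt (complex.Re (f x) ^+ 2 + complex.Im (f x) ^+ 2))).
  apply: (measurableT_comp (continuous_measurable_fun (@sqrt_continuous R))).
  by apply: measurable_funD; apply: measurable_funX.
by apply/funext => x; case: (f x).
Qed.

Variable m : {finite_measure set T -> \bar R}.

Lemma bounded_integrable (f : T -> R) : measurable_fun setT f ->
  (exists M : R, forall x, `|f x| <= M) -> m.-integrable setT (EFin \o f).
Proof.
move=> mf [M fM]; apply: measurable_bounded_integrable => //.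
  by rewrite -ge0_fin_numE// fin_num_measure.
exists M; split; first exact: num_real.
by move=> N MN x _ /=; rewrite (le_trans (fM x))// ltW.
Qed.

Lemma cbm_Re f : cbm f -> m.-integrable setT (fun x => (complex.Re (f x))%:E).
Proof.
move=> [f1 f2 [M fM]]; apply: bounded_integrable => //.
by exists M => x; rewrite (le_trans (Re_le_normc _)).
Qed.

Lemma cbm_Im f : cbm f -> m.-integrable setT (fun x => (complex.Im (f x))%:E).
Proof.
move=> [f1 f2 [M fM]]; apply: bounded_integrable => //.
by exists M => x; rewrite (le_trans (Im_le_normc _)).
Qed.

End bounded_measurable.

Lemma cbm_comp {d1 d2} {T1 : measurableType d1} {T2 : measurableType d2}
    {R : realType} (f : T2 -> R[i]) (h : T1 -> T2) :
  measurable_fun setT h -> cbm f -> cbm (fun x => f (h x)).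
Proof.
move=> mh [f1 f2 [M fM]]; split; [exact: (measurableT_comp f1 mh)|
  exact: (measurableT_comp f2 mh)|by exists M].
Qed.

Section cintegral.
Context {dT} {T : measurableType dT} {R : realType}.
Implicit Types f g : T -> R[i].

Definition cintegral (m : {measure set T -> \bar R}) f : R[i] :=
  ((\int[m]_x complex.Re (f x)) +i* (\int[m]_x complex.Im (f x)))%C.

Arguments cintegral : simpl never.

Variable m : {finite_measure set T -> \bar R}.

Lemma cintegralD f g : cbm f -> cbm g -> 
  cintegral m (fun x => f x + g x) = cintegral m f + cintegral m g.
Proof.
move=> hf hg; rewrite /cintegral.
under eq_Rintegral do rewrite raddfD.
rewrite RintegralD//; try exact: cbm_Re.
under [X in (_ +i* X)%C = _]eq_Rintegral do rewrite raddfD.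
by rewrite RintegralD//; exact: cbm_Im.
Qed.

Lemma cintegralZ z f : cbm f -> cintegral m (fun x => z * f x) = z * cintegral m f.
Proof.
move=> hf; rewrite /cintegral; case: z => a b.
have E (x : T) : ((a +i* b) * f x = (a * complex.Re (f x) - b * complex.Im (f x))
   +i* (a * complex.Im (f x) + b * complex.Re (f x)))%C by case: (f x).
under eq_Rintegral do rewrite E /=.
under [X in (_ +i* X)%C = _]eq_Rintegral do rewrite E /=.
have iR := cbm_Re m hf. have iI := cbm_Im m hf.
rewrite RintegralB//; [|exact: (integrableZl _ a iR)|exact: (integrableZl _ b iI)].
rewrite RintegralD//; [|exact: (integrableZl _ a iI)|exact: (integrableZl _ b iR)].
by rewrite !RintegralZl.
Qed.

(** Real and imaginary parts are bounded separately, hence the factor 2. *)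
Lemma cintegral_normc f : cbm f ->
  ((normc (cintegral m f))%:E <= 2%:E * \int[m]_x (normc (f x))%:E)%E.
Proof.
move=> hf.
have mn := cbm_measurable_normc hf.
have nint : m.-integrable setT (fun x => (normc (f x))%:E).
  apply: bounded_integrable => //; case: hf => _ _ [M fM].
  by exists M => x; rewrite ger0_norm ?normc_ge0.
rewrite -(fineK (integrable_fin_num _ nint))// -EFinM lee_fin.
rewrite (le_trans (normc_le_ReIm _))// mulrDl mul1r /= lerD//.
  rewrite (le_trans (le_normr_Rintegral _ (cbm_Re m hf)))//.
  apply: le_Rintegral => //; last by move=> x _; exact: Re_le_normc.
  exact: (integrable_abse (cbm_Re m hf)).
rewrite (le_trans (le_normr_Rintegral _ (cbm_Im m hf)))//.
apply: le_Rintegral => //; last by move=> x _; exact: Im_le_normc.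
exact: (integrable_abse (cbm_Im m hf)).
Qed.

Lemma cintegralJ f : cbm f -> cintegral m (fun x => conjc (f x)) = conjc (cintegral m f).
Proof.
move=> hf; rewrite /cintegral /=; congr (_ +i* _)%C.
  by apply: eq_Rintegral => x _; case: (f x).
rewrite -mulN1r -RintegralZl//; last exact: cbm_Im.
by apply: eq_Rintegral => x _; rewrite mulN1r; case: (f x).
Qed.

End cintegral.
Arguments cintegral : simpl never.

(** * Fubini for bounded measurable functions *)

Section Fubini.
Context {d1 d2} {T1 : measurableType d1} {T2 : measurableType d2} {R : realType}.
Variables (m1 : {finite_measure set T1 -> \bar R}) (m2 : {finite_measure set T2 -> \bar R}).

Lemma bounded_integrable_prod (F : T1 * T2 -> R) : measurable_fun setT F ->
  (exists M : R, forall z, `|F z| <= M) ->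
  (m1 \x m2)%E.-integrable setT (EFin \o F).
Proof.
move=> mF [M FM]; apply: measurable_bounded_integrable => //; last first.
  exists M; split; first exact: num_real.
  by move=> N MN x _ /=; rewrite (le_trans (FM x))// ltW.
rewrite -ge0_fin_numE//.
have : (m1 \x m2)%E (setT `*` setT) \is a fin_num.
  by rewrite product_measure1E// fin_numM// fin_num_measure.
by rewrite setXTT.
Qed.

End Fubini.

Section real_Fubini.
Context {d1 d2} {T1 : measurableType d1} {T2 : measurableType d2} {R : realType}.
Variable F : T1 * T2 -> R.
Hypotheses (mF : measurable_fun setT F) (bF : exists M : R, forall z, `|F z| <= M).

Let fin1 (m2 : {finite_measure set T2 -> \bar R}) x :
  m2.-integrable setT (fun y => (F (x, y))%:E).
Proof.
apply: bounded_integrable; first exact: measurableT_comp.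
by have [M FM] := bF; exists M.
Qed.

Let fin2 (m1 : {finite_measure set T1 -> \bar R}) y :
  m1.-integrable setT (fun x => (F (x, y))%:E).
Proof.
apply: bounded_integrable; first exact: measurableT_comp.
by have [M FM] := bF; exists M.
Qed.

Lemma measurable_Rintegral_pair (m2 : {finite_measure set T2 -> \bar R}) :
  measurable_fun setT (fun x => \int[m2]_y F (x, y)).
Proof.
apply/measurable_EFinP; rewrite (_ : EFin \o _ = fubini_F m2 (EFin \o F)).
  (* measurability in x involves no measure on T1, so the null measure will do *)
  exact: measurable_fubini_F (bounded_integrable_prod mzero m2 mF bF).
apply/funext => x; rewrite /= /Rintegral fineK//.
exact: (integrable_fin_num _ (fin1 m2 x)).
Qed.

Lemma Rintegral_fubini (m1 : {finite_measure set T1 -> \bar R})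
    (m2 : {finite_measure set T2 -> \bar R}) :
  \int[m1]_x \int[m2]_y F (x, y) = \int[m2]_y \int[m1]_x F (x, y).
Proof.
congr fine; transitivity (\int[m1]_x \int[m2]_y (F (x, y))%:E)%E.
  by apply: eq_integral => x _; rewrite fineK//; exact: (integrable_fin_num _ (fin1 m2 x)).
rewrite (Fubini (bounded_integrable_prod m1 m2 mF bF)); apply: eq_integral => y _.
by rewrite fineK//; exact: (integrable_fin_num _ (fin2 m1 y)).
Qed.

End real_Fubini.

Section complex_Fubini.
Context {d1 d2} {T1 : measurableType d1} {T2 : measurableType d2} {R : realType}.
Variable F : T1 * T2 -> R[i].
Hypothesis hF : cbm F.

Let bRe : exists M : R, forall z, `|complex.Re (F z)| <= M.
Proof.
by have [_ _ [M FM]] := hF; exists M => x; rewrite (le_trans (Re_le_normc _)).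
Qed.

Let bIm : exists M : R, forall z, `|complex.Im (F z)| <= M.
Proof.
by have [_ _ [M FM]] := hF; exists M => x; rewrite (le_trans (Im_le_normc _)).
Qed.

Lemma cbm_pair1 x : cbm (fun y => F (x, y)).
Proof. exact: (cbm_comp (f := F)). Qed.

Lemma cbm_pair2 y : cbm (fun x => F (x, y)).
Proof. exact: (cbm_comp (f := F)). Qed.

Lemma cintegral_cbm (m2 : {finite_measure set T2 -> \bar R}) :
  cbm (fun x => cintegral m2 (fun y => F (x, y))).
Proof.
have [F1 F2 [M FM]] := hF; split.
- exact: (measurable_Rintegral_pair F1 bRe m2).
- exact: (measurable_Rintegral_pair F2 bIm m2).
- exists (2 * (M * fine (m2 setT))) => x.
  have fm2 : (m2 setT)%E \is a fin_num by rewrite fin_num_measure.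
  rewrite -lee_fin (le_trans (cintegral_normc m2 (cbm_pair1 x)))//.
  rewrite EFinM lee_pmul2l// EFinM fineK// -integral_cst//.
  apply: ge0_le_integral => //.
  + by move=> y _; rewrite lee_fin normc_ge0.
  + by apply/measurable_EFinP; exact: (cbm_measurable_normc (cbm_pair1 x)).
  + by move=> y _; rewrite lee_fin.
Qed.

Lemma cintegral_fubini (m1 : {finite_measure set T1 -> \bar R})
    (m2 : {finite_measure set T2 -> \bar R}) :
  cintegral m1 (fun x => cintegral m2 (fun y => F (x, y))) =
  cintegral m2 (fun y => cintegral m1 (fun x => F (x, y))).
Proof.
have [F1 F2 _] := hF.
by rewrite /cintegral /= (Rintegral_fubini F1 bRe) (Rintegral_fubini F2 bIm).
Qed.

End complex_Fubini.

(** * Finite complex measures *)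

(** A complex measure presented as a finite combination of finite positive ones.
    An arbitrary index type, rather than the four coefficients [1, i, -1, -i],
    makes differences and conjugates as easy to form as Lebesgue measure itself. *)
Record fcm {dT} (T : measurableType dT) (R : realType) := Fcm {
  fcm_index : finType ;
  fcm_coef : fcm_index -> R[i] ;
  fcm_part : fcm_index -> {finite_measure set T -> \bar R} }.

Section cint.
Context {dT} {T : measurableType dT} {R : realType}.
Implicit Types (L : fcm T R) (f g : T -> R[i]).

Definition cint L f : R[i] :=
  \sum_(k : fcm_index L) fcm_coef k * cintegral (fcm_part k) f.

Lemma cintD L f g : cbm f -> cbm g ->
  cint L (fun x => f x + g x) = cint L f + cint L g.
Proof.
move=> hf hg; rewrite /cint -big_split; apply: eq_bigr => k _.
by rewrite cintegralD// mulrDr.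
Qed.

Lemma cintZ L z f : cbm f -> cint L (fun x => z * f x) = z * cint L f.
Proof.
move=> hf; rewrite /cint big_distrr; apply: eq_bigr => k _ /=.
by rewrite cintegralZ// mulrCA.
Qed.

Lemma cintB L f g : cbm f -> cbm g ->
  cint L (fun x => f x - g x) = cint L f - cint L g.
Proof.
move=> hf hg; under eq_fun do rewrite -mulN1r.
by rewrite cintD ?cintZ ?mulN1r//; exact: cbmZ.
Qed.

Lemma cint0 L : cint L (fun=> 0) = 0.
Proof.
rewrite -[RHS](mul0r (cint L (fun=> 0))) -cintZ; last exact: cbm_cst.
by congr cint; apply/funext => x; rewrite mul0r.
Qed.

Lemma cint_sum L (I : Type) (s : seq I) (F : I -> T -> R[i]) :
  (forall i, cbm (F i)) ->
  cint L (fun x => \sum_(i <- s) F i x) = \sum_(i <- s) cint L (F i).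
Proof.
move=> hF; elim: s => [|i s ih].
  by rewrite big_nil; under eq_fun do rewrite big_nil; exact: cint0.
rewrite big_cons -ih -cintD//; last exact: cbm_sum.
by congr cint; apply/funext => x; rewrite big_cons.
Qed.

Definition fcm_conj L := @Fcm _ T R (fcm_index L)
  (fun k => conjc (fcm_coef k)) (@fcm_part _ _ _ L).

Lemma cint_conj L f : cbm f ->
  cint (fcm_conj L) f = conjc (cint L (fun x => conjc (f x))).
Proof.
move=> hf; rewrite /cint rmorph_sum; apply: eq_bigr => k _.
rewrite rmorphM; congr (_ * _); rewrite -[RHS]cintegralJ; last exact: cbmJ.
by congr cintegral; apply/funext => x; rewrite conjcK.
Qed.

Definition fcm_sub L L' := @Fcm _ T R (fcm_index L + fcm_index L')%type
  (fun k => match k with inl i => fcm_coef i | inr j => - fcm_coef j end)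
  (fun k => match k with inl i => fcm_part i | inr j => fcm_part j end).

Lemma cint_sub L L' f : cint (fcm_sub L L') f = cint L f - cint L' f.
Proof.
rewrite /cint big_sumType /= -sumrN; congr (_ + _).
by apply: eq_bigr => j _; rewrite mulNr.
Qed.

Definition fcm_pos (m : {finite_measure set T -> \bar R}) :=
  @Fcm _ T R unit (fun=> 1) (fun=> m).

Lemma cint_pos m f : cint (fcm_pos m) f = cintegral m f.
Proof.
by rewrite /cint (bigD1 tt)//= big_pred0 ?addr0 ?mul1r// => -[].
Qed.

End cint.

Section cint_fubini.
Context {d1 d2} {T1 : measurableType d1} {T2 : measurableType d2} {R : realType}.
Variables (L1 : fcm T1 R) (L2 : fcm T2 R) (F : T1 * T2 -> R[i]).
Hypothesis hF : cbm F.

Lemma cbm_cint : cbm (fun x => cint L2 (fun y => F (x, y))).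
Proof. by apply: cbm_sum => k; apply: cbmZ; exact: cintegral_cbm. Qed.

Let hswap : cbm (fun z : T2 * T1 => F (z.2, z.1)).
Proof. exact: (cbm_comp (f := F) (@measurable_swap _ _ T2 T1)). Qed.

Lemma cint_fubini :
  cint L1 (fun x => cint L2 (fun y => F (x, y))) =
  cint L2 (fun y => cint L1 (fun x => F (x, y))).
Proof.
rewrite {2}/cint [LHS]cint_sum; last by move=> k; apply: cbmZ; exact: cintegral_cbm.
rewrite [RHS]/cint; apply: eq_bigr => k _.
rewrite cintZ; last exact: cintegral_cbm.
congr (_ * _); rewrite /cint.
transitivity (\sum_(j : fcm_index L1) fcm_coef j *
    cintegral (fcm_part k) (fun y => cintegral (fcm_part j) (fun x => F (x, y)))).
  by apply: eq_bigr => j _; rewrite cintegral_fubini.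
rewrite -[RHS]mul1r -[1]/(fcm_coef (f := fcm_pos (fcm_part k)) tt).
rewrite -[cintegral _ _ in RHS]cint_pos mul1r.
rewrite (@cint_sum _ _ _ (fcm_pos (fcm_part k))); last first.
  by move=> j; apply: cbmZ; exact: (cintegral_cbm hswap _).
apply: eq_bigr => j _; rewrite cint_pos cintegralZ//.
exact: (cintegral_cbm hswap _).
Qed.

End cint_fubini.

(** * The topology of the complex numbers *)

Section complex_topology.
Variable R : realType.

Lemma ltc_gt0 (e : R[i]) : 0 < e -> 0 < complex.Re e /\ e = (complex.Re e)%:C%C.
Proof. by case: e => a b; rewrite ltcE /= => /andP[/eqP -> ?]. Qed.

(** The topology of [R[i]^o] is defined by radii in [R[i]]; this brings
    convergence back to real radii and the real-valued modulus. *)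
Lemma cvgC_normc {T : Type} {F : set_system T} {FF : Filter F} (f : T -> R[i]^o)
    (l : R[i]^o) :
  f @ F --> l <-> forall e : R, 0 < e -> \forall t \near F, normc (l - f t) < e.
Proof.
split=> [/cvgrPdist_lt h e e0|h]; last first.
  apply/cvgrPdist_lt => e /ltc_gt0[e0 ->]; apply: filterS (h _ e0) => t.
  by rewrite normc_norm ltcR.
have /h : (0 : R[i]) < e%:C%C by rewrite ltcR.
by apply: filterS => t; rewrite normc_norm ltcR.
Qed.

Lemma cvgr_Re {T : Type} {F : set_system T} {FF : Filter F} (f : T -> R[i]^o)
    (l : R[i]^o) :
  f @ F --> l -> complex.Re (f t) @[t --> F] --> complex.Re l.
Proof.
move=> /cvgC_normc h; apply/cvgrPdist_lt => e /h; apply: filterS => t.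
by apply: le_lt_trans; rewrite -raddfB; exact: Re_le_normc.
Qed.

Lemma cvgr_Im {T : Type} {F : set_system T} {FF : Filter F} (f : T -> R[i]^o)
    (l : R[i]^o) :
  f @ F --> l -> complex.Im (f t) @[t --> F] --> complex.Im l.
Proof.
move=> /cvgC_normc h; apply/cvgrPdist_lt => e /h; apply: filterS => t.
by apply: le_lt_trans; rewrite -raddfB; exact: Im_le_normc.
Qed.

End complex_topology.

(** * Measurability and compactness in R^d *)

Section euclidean_space.
Variables (R : realType) (d : nat).
Local Notation V := ('rV[R]_d).
Local Notation E := (Rd R d).
Local Notation vol := (@lebesgue_Rd R d).

Lemma ler_rV_norm (v : V) (r : R) : 0 <= r ->
  (`|v| <= r) <-> forall i, `|v ord0 i| <= r.
Proof.
move=> r0; rewrite [X in X <= _]/Num.Def.normr /= mx_normrE; split => h.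
  by move=> i; rewrite (le_trans _ h)//; apply/bigmax_geP; right; exists (ord0, i).
by apply/bigmax_leP; split => // -[i j] _ /=; rewrite (ord1 i).
Qed.

(** A closed ball, since the norm of row vectors is the sup norm. *)
Definition cube (w : V) (r : R) : set V := [set v | `|v - w| <= r].

Lemma cube_box w r : 0 <= r -> cube w r = box (w - const_mx r) (w + const_mx r).
Proof.
move=> r0; apply/seteqP; split => v.
  by move=> /(ler_rV_norm _ r0) h i; rewrite !mxE -ler_distl; have := h i; rewrite !mxE.
by move=> h; apply/(ler_rV_norm _ r0) => i; rewrite !mxE ler_distl; have := h i; rewrite !mxE.
Qed.

Lemma vol_cube w r : 0 <= r -> vol (cube w r : set E) = ((r *+ 2) ^+ d)%:E.
Proof.
move=> r0; rewrite cube_box// lebesgue_Rd_box; last first.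
  by move=> i; rewrite !mxE lerD2l (le_trans _ r0)// oppr_le0.
rewrite (eq_bigr (fun=> r *+ 2)) ?prodr_const ?card_ord// => i _.
by rewrite !mxE opprD opprK addrACA subrr add0r mulr2n.
Qed.

Lemma open_measurable_Rd (U : set V) : open U -> measurable (U : set E).
Proof. by move=> oU; apply: sub_sigma_algebra. Qed.

Lemma closed_measurable_Rd (U : set V) : closed U -> measurable (U : set E).
Proof.
move=> cU; rewrite -(setCK U); apply: measurableC; apply: open_measurable_Rd.
exact: closed_openC.
Qed.

Lemma closed_cube w r : closed (cube w r).
Proof.
have cf : continuous (fun v : V => `|v - w|).
  by move=> v; exact: (cvg_norm (cvgB cvg_id (cvg_cst w))).
rewrite (_ : cube w r = (fun v => `|v - w|) @^-1` [set x | x <= r])//.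
by apply: preimage_closed; [move=> v _; exact: cf|exact: closed_le].
Qed.

Lemma measurable_cube w r : measurable (cube w r : set E).
Proof. by apply: closed_measurable_Rd; exact: closed_cube. Qed.

Lemma compact_cube w r : compact (cube w r).
Proof.
apply: bounded_closed_compact; last exact: closed_cube.
exists (`|w| + r); split; first exact: num_real.
move=> M hM v /= h; rewrite (le_trans _ (ltW hM))// -(subrK w v) addrC.
by rewrite (le_trans (ler_normD _ _))// lerD2l.
Qed.

Lemma compact_sub_cube (A : set V) : compact A ->
  exists2 r : R, 0 < r & A `<=` cube 0 r.
Proof.
move=> /compact_bounded[M [Mr h]]; exists (`|M| + 1).
  by rewrite ltr_wpDl.
move=> v Av; rewrite /cube /= subr0; apply: h Av.
by rewrite (le_lt_trans (ler_norm _))// ltrDl.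
Qed.

Lemma compact_closed_Rd (A : set V) : compact A -> closed A.
Proof. by apply: compact_closed; exact: norm_hausdorff. Qed.

Lemma compact_measurable_Rd (A : set V) : compact A -> measurable (A : set E).
Proof. by move=> /compact_closed_Rd; exact: closed_measurable_Rd. Qed.

Lemma vol_bounded (A : set V) r : A `<=` cube 0 r -> measurable (A : set E) ->
  (vol A < +oo)%E.
Proof.
move=> Ar mA; have Ar' : A `<=` cube 0 `|r|.
  by move=> v /Ar /le_trans; apply; exact: ler_norm.
apply: (@le_lt_trans _ _ (vol (cube 0 `|r| : set E))).
  by apply: le_measure; rewrite ?inE//; exact: measurable_cube.
by rewrite vol_cube// ltry.
Qed.

Lemma vol_compact (A : set V) : compact A -> (vol A < +oo)%E.
Proof.
move=> cA; have [r _ Ar] := compact_sub_cube cA.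
by apply: (vol_bounded Ar); exact: compact_measurable_Rd.
Qed.

Definition sumset (A K : set V) : set V := [set a + k | a in A & k in K].

Lemma compact_image2 (f : V * V -> V) (A K : set V) : continuous f ->
  compact A -> compact K -> compact [set f (a, k) | a in A & k in K].
Proof.
move=> cf cA cK.
rewrite (_ : [set _ | _ in A & _ in K] = f @` (A `*` K)).
  apply: continuous_compact; last exact: compact_setX.
  exact: continuous_subspaceT.
apply/seteqP; split => [_ [a Aa [k Kk <-]]|_ [[a k] [/= Aa Kk] <-]].
  by exists (a, k).
by exists a => //; exists k.
Qed.

Lemma compact_sumset (A K : set V) : compact A -> compact K -> compact (sumset A K).
Proof.
have cf : continuous (fun z : V * V => z.1 + z.2).
  by move=> z; exact: (cvgD cvg_fst cvg_snd).
exact: (compact_image2 cf).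
Qed.

Lemma compact_diffset (A K : set V) : compact A -> compact K ->
  compact [set b - k | b in A & k in K].
Proof.
have cf : continuous (fun z : V * V => z.1 - z.2).
  by move=> z; exact: (cvgB cvg_fst cvg_snd).
exact: (compact_image2 cf).
Qed.

(** Exhausting [F] by compact sets makes the difference set a countable union of
    compact sets. *)
Lemma measurable_diffset (F K : set V) : closed F -> compact K ->
  measurable ([set b - k | b in F & k in K] : set E).
Proof.
move=> cF cK.
have -> : [set b - k | b in F & k in K] =
    \bigcup_n [set b - k | b in F `&` cube 0 n%:R & k in K].
  apply/seteqP; split => [_ [b Fb [k Kk <-]]|_ [n _ [b [Fb _] [k Kk <-]]]].
    exists (Num.truncn `|b|).+1 => //; exists b; last by exists k.
    by split => //; rewrite /cube /= subr0 ltW// truncnS_gt.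
  by exists b => //; exists k.
apply: bigcupT_measurable => n; apply: compact_measurable_Rd.
apply: compact_diffset => //; rewrite setIC.
by apply: compact_closedI => //; exact: compact_cube.
Qed.

Lemma measurable_coord i : measurable_fun setT (fun v : E => v ord0 i).
Proof.
apply: (@measurability _ _ _ _ _ _ (@RGenOpens.G R) (RGenOpens.measurableE R)).
move=> _ [_ [a [b ->] <-]]; rewrite setTI; apply: open_measurable_Rd.
apply: open_comp; last exact: interval_open.
by move=> v _; exact: coord_continuous.
Qed.

Lemma continuous_measurable_Rd (f : V -> R) : continuous f ->
  measurable_fun setT (f : E -> R).
Proof.
move=> cf.
apply: (@measurability _ _ _ _ _ _ (@RGenOpens.G R) (RGenOpens.measurableE R)).
move=> _ [_ [a [b ->] <-]]; rewrite setTI; apply: open_measurable_Rd.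
by apply: open_comp; [move=> v _; exact: cf|exact: interval_open].
Qed.

(** The sigma-algebra is generated by all open sets, not by boxes; an open set is
    a countable union of cubes with rational centre and size. It gives
    measurability of [(s, t) |-> s - t] for the product sigma-algebra. *)
Lemma measurable_rowP {dT} {T : measurableType dT} (f : T -> E) :
  (forall i, measurable_fun setT (fun x => f x ord0 i)) -> measurable_fun setT f.
Proof.
move=> mf; apply: (@measurability _ _ _ E setT f (@open V)) => //.
move=> _ [U oU <-]; rewrite setTI.
pose c (i : 'rV[rat]_d * rat) : set V := cube (map_mx ratr i.1) (ratr i.2).
have -> : f @^-1` U = \bigcup_i (f @^-1` (if pselect (c i `<=` U) then c i else set0)).
  apply/seteqP; split => [x /= Ux|x [i _]]; last first.
    by rewrite /preimage /=; case: pselect => // cU /cU.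
  have /nbhs_ballP[e /= e0 eU] := open_nbhs_nbhs (conj oU Ux).
  have /rat_in_itvoo[r] : 0 < e / 2 by rewrite divr_gt0.
  rewrite in_itv/= => /andP[r0 re].
  have apx (y : R) : exists q : rat, `|y - ratr q| <= ratr r.
    have /rat_in_itvoo[q] : y - ratr r < y + ratr r.
      by rewrite ltrBlDr -addrA ltrDl addr_gt0.
    by rewrite in_itv/= => /andP[q1 q2]; exists q; rewrite distrC ler_distl !ltW.
  pose w : 'rV[rat]_d := \row_j projT1 (cid (apx (f x ord0 j))).
  have xw : c (w, r) (f x).
    by apply/(ler_rV_norm _ (ltW r0)) => i; rewrite !mxE; case: cid.
  exists (w, r) => //; rewrite /preimage /=; case: pselect => // -[] y yw; apply: eU.
  rewrite -ball_normE /ball_ /= -(subrKA (map_mx ratr w)).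
  rewrite (le_lt_trans (ler_normD _ _))// (splitr e) ltr_leD//.
    exact: (le_lt_trans xw).
  by rewrite distrC (le_trans yw)// ltW.
apply: countable_bigcupT_measurable => [|i]; first exact: countableP.
case: pselect => ? /=; last by rewrite preimage_set0.
have [r0|r0] := leP 0 (ratr i.2 : R); last first.
  rewrite (_ : _ @^-1` _ = set0)//; apply/seteqP; split => // x.
  by rewrite /preimage /c /cube /= => /le_lt_trans/(_ r0); rewrite ltNge normr_ge0.
rewrite (_ : _ @^-1` _ = \bigcap_(j in [set: 'I_d])
    ((fun x => f x ord0 j) @^-1` `[ratr (i.1 ord0 j) - ratr i.2, ratr (i.1 ord0 j) + ratr i.2])).
  apply: fin_bigcap_measurable => [|j _]; first exact: finite_finset.
  by rewrite -[X in measurable X]setTI; exact: mf.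
apply/seteqP; split => x.
  move=> /(ler_rV_norm _ r0) h j _; have := h j.
  by rewrite !mxE /= in_itv /= ler_distl.
move=> h; apply/(ler_rV_norm _ r0) => j; have := h j Logic.I.
by rewrite !mxE /= in_itv /= ler_distl.
Qed.

Lemma measurable_addRd {dT} {T : measurableType dT} (f g : T -> E) :
  measurable_fun setT f -> measurable_fun setT g ->
  measurable_fun setT (fun x => (f x : V) + g x : E).
Proof.
move=> mf mg; apply: measurable_rowP => i; under eq_fun do rewrite mxE.
by apply: measurable_funD; exact: (measurableT_comp (measurable_coord i)).
Qed.

Lemma measurable_subRd {dT} {T : measurableType dT} (f g : T -> E) :
  measurable_fun setT f -> measurable_fun setT g ->
  measurable_fun setT (fun x => (f x : V) - g x : E).
Proof.
move=> mf mg; apply: measurable_rowP => i; under eq_fun do rewrite !mxE.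
by apply: measurable_funB; exact: (measurableT_comp (measurable_coord i)).
Qed.

End euclidean_space.

(** * Continuous functions with compact support *)

Section compactly_supported.
Variables (R : realType) (d : nat).
Local Notation V := ('rV[R]_d).
Local Notation E := (Rd R d).
Local Notation C := (R[i]^o).
Implicit Types g : V -> C.

Lemma ler_dist_normc (z w : R[i]) : `|normc z - normc w| <= normc (z - w).
Proof.
have h1 := le_normcD (z - w) w; have h2 := le_normcD (w - z) z.
by move: h1 h2; rewrite !subrK -(normcN (w - z)) opprB ler_norml; lra.
Qed.

Lemma continuous_normcP g : continuous g <->
  forall x (e : R), 0 < e -> \forall y \near x, normc (g x - g y) < e.
Proof.
split=> [cg x|h x].
  exact: ((cvgC_normc (F := nbhs x) g (g x)).1 (cg x)).
by apply: ((cvgC_normc (F := nbhs x) g (g x)).2); exact: h.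
Qed.

Lemma continuous_normc_comp g : continuous g -> continuous (fun x => normc (g x)).
Proof.
move=> cg x; apply: ((cvgrPdist_lt (F := nbhs x) _ _).2) => e e0.
have := (continuous_normcP g).1 cg x e e0; apply: filterS => t.
by apply: le_lt_trans; exact: ler_dist_normc.
Qed.

Lemma Cc_support g : Cc g -> exists2 rho : R, 0 < rho & forall x, rho < `|x| -> g x = 0.
Proof.
move=> [_ /compact_sub_cube[rho r0 h]]; exists rho => // x xr.
apply/eqP; apply: contraTT xr => gx; rewrite -leNgt.
by have := h x (@subset_closure _ [set y | g y != 0] x gx); rewrite /cube /= subr0.
Qed.

Lemma Cc_bounded g : Cc g -> exists2 M : R, 0 <= M & forall x, normc (g x) <= M.
Proof.
move=> cg; have [rho r0 grho] := Cc_support cg.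
have cn := continuous_normc_comp cg.1.
have : compact [set normc (g x) | x in cube 0 rho].
  apply: continuous_compact; last exact: compact_cube.
  exact: continuous_subspaceT.
move=> /compact_bounded[M [Mr h]]; exists (`|M| + 1); first by rewrite addr_ge0.
move=> x; have [xr|xr] := leP `|x| rho; last first.
  by rewrite grho// normc0 addr_ge0.
rewrite (le_trans (ler_norm _))//; apply: h.
  by rewrite (le_lt_trans (ler_norm _))// ltrDl.
by exists x => //; rewrite /cube /= subr0.
Qed.

Lemma Cc_cbm g : Cc g -> cbm (g : E -> R[i]).
Proof.
move=> cg; split.
- apply: continuous_measurable_Rd => x; exact: (cvgr_Re (F := nbhs x) (cg.1 x)).
- apply: continuous_measurable_Rd => x; exact: (cvgr_Im (F := nbhs x) (cg.1 x)).
- by have [M _ gM] := Cc_bounded cg; exists M.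
Qed.

Lemma Cc_intro g (rho : R) : continuous g -> (forall x, rho < `|x| -> g x = 0) -> Cc g.
Proof.
move=> cg grho; split => //.
apply: (@subclosed_compact _ _ (cube 0 rho)).
- exact: closed_closure.
- exact: compact_cube.
- rewrite ((closure_id _).1 (@closed_cube R d 0 rho)).
  apply: closure_subset => x gx; rewrite /cube /= subr0 leNgt.
  by apply/negP => /grho gx0; move: gx; rewrite /= gx0 eqxx.
Qed.

Lemma Cc_unif g (e : R) : Cc g -> 0 < e ->
  exists2 delta : R, 0 < delta &
    forall u v, `|u - v| <= delta -> normc (g u - g v) <= e.
Proof.
move=> cg e0; have [rho r0 grho] := Cc_support cg.
have /compact_near_coveringP cc := @compact_cube R d 0 (rho + 1).
pose P (r : R) (u : V) := forall v, `|u - v| <= r -> normc (g u - g v) <= e.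
have : \forall r \near 0^'+, cube 0 (rho + 1) `<=` P r.
  apply: cc => x _.
  have e20 : 0 < e / 2 by rewrite divr_gt0.
  have /nbhs_ballP[a /= a0 ha] := (continuous_normcP g).1 cg.1 x _ e20.
  near=> u r => v uv.
  have xu : `|x - u| < a / 2.
    near: u.
    have : nbhs x (ball x (a / 2)) by apply: nbhsx_ballx; rewrite divr_gt0.
    by apply: filterS => u; rewrite -ball_normE.
  have r2 : r <= a / 2 by near: r; apply: nbhs_right_le; rewrite divr_gt0.
  have hu : normc (g x - g u) < e / 2.
    apply: ha; rewrite -ball_normE /ball_ /= (lt_trans xu)//.
    by rewrite ltr_pdivrMr// ltr_pMr// ltr1n.
  have hv : normc (g x - g v) < e / 2.
    apply: ha; rewrite -ball_normE /ball_ /= -(subrKA u) (splitr a).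
    by rewrite (le_lt_trans (ler_normD _ _))// ltr_leD// (le_trans uv).
  rewrite -(subrKA (g x)) (le_trans (le_normcD _ _))// (splitr e) lerD//.
    by rewrite -normcN opprB ltW.
  exact: ltW.
move=> h.
have : \forall r \near 0^'+, [/\ 0 < r, r <= 1 & cube 0 (rho + 1) `<=` P r].
  near=> r; split; near: r; [exact: nbhs_right_gt| |exact: h].
  by apply: nbhs_right_le.
move=> /filter_ex[r [r_gt0 r1 hP]].
exists r => // u v uv.
have [ur|ur] := leP `|u| (rho + 1).
  by apply: hP => //; rewrite /cube /= subr0.
have vr : rho < `|v|.
  have := ler_normD (u - v) v; rewrite subrK => uv'; lra.
by rewrite !grho ?subrr ?normc0 ?ltW//; lra.
Unshelve. all: by end_near. Qed.

Lemma Cc_comp_shift g (x : V) : Cc g -> Cc (fun y => g (x - y)).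
Proof.
move=> cg; have [rho r0 grho] := Cc_support cg.
apply: (@Cc_intro _ (rho + `|x|)) => [y|y xy].
  have cs : continuous (fun y : V => x - y).
    by move=> z; apply: (cvgB (cvg_cst x) cvg_id); exact: (nbhs_filter z).
  exact: (continuous_comp (cs y) (cg.1 (x - y))).
apply: grho; have := ler_normD (y - x) x; rewrite subrK distrC; lra.
Qed.

Lemma Cc_opp g : Cc g -> Cc (fun y => g (- y)).
Proof.
by move=> /(@Cc_comp_shift _ 0); under eq_fun do rewrite sub0r.
Qed.

Lemma Cc_conj g : Cc g -> Cc (fun y => conjc (g y)).
Proof.
move=> cg; have [rho r0 grho] := Cc_support cg.
apply: (@Cc_intro _ rho) => [|y /grho ->]; last exact: conjc0.
apply/continuous_normcP => y e /((continuous_normcP g).1 cg.1 y).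
by apply: filterS => t; rewrite -rmorphB normcJ.
Qed.

Lemma Cc_tilde g : Cc g -> Cc (tilde_fun g).
Proof. by move=> /Cc_opp/Cc_conj. Qed.

End compactly_supported.

(** * Radon measures on compact sets, and their total variation *)

Section restriction.
Context {dT} {T : measurableType dT} {R : realType}.
Variables (m : {measure set T -> \bar R}) (A : set T) (mA : measurable A).
Hypothesis moo : (m A < +oo)%E.

Lemma integral_mfrestr (f : T -> R) : measurable_fun setT f ->
  (exists M : R, forall x, `|f x| <= M) ->
  (\int[mfrestr mA moo]_x (f x)%:E = \int[m]_(x in A) (f x)%:E)%E.
Proof.
move=> mf bf; rewrite (@negligible_integral _ _ _ _ setT (~` A))//; last 3 first.
- exact: measurableC.
- exact: (bounded_integrable (mfrestr mA moo) mf bf).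
- by rewrite /= /mfrestr /mrestr setICl measure0.
rewrite setTD setCK; apply: eq_measure_integral => B mB BA.
by rewrite /= /mfrestr /mrestr setIidl.
Qed.

Lemma Rintegral_mfrestr (f : T -> R) : measurable_fun setT f ->
  (exists M : R, forall x, `|f x| <= M) ->
  \int[mfrestr mA moo]_x f x = \int[m]_(x in A) f x.
Proof. by move=> mf bf; congr fine; exact: integral_mfrestr. Qed.

Lemma cintegral_mfrestr (f : T -> R[i]) : cbm f ->
  cintegral (mfrestr mA moo) f =
  ((\int[m]_(x in A) complex.Re (f x)) +i* (\int[m]_(x in A) complex.Im (f x)))%C.
Proof.
move=> [f1 f2 [M fM]]; rewrite /cintegral !Rintegral_mfrestr//.
- by exists M => x; rewrite (le_trans (Im_le_normc _)).
- by exists M => x; rewrite (le_trans (Re_le_normc _)).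
Qed.

End restriction.

Section mass.
Context {dT} {T : measurableType dT} {R : realType}.
Implicit Types L : fcm T R.

(** An upper bound for the total mass, depending on the presentation of the
    measure: good enough for errors that tend to zero with the measure fixed, but
    not controlled by the total variation. *)
Definition mass L : R := \sum_(k : fcm_index L)
  normc (fcm_coef k) * (2 * fine (fcm_part k setT)).

Lemma mass_ge0 L : 0 <= mass L.
Proof.
by apply: sumr_ge0 => k _; rewrite mulr_ge0 ?normc_ge0// mulr_ge0// fine_ge0.
Qed.

Lemma cint_le_mass L (f : T -> R[i]) (c : R) : cbm f ->
  (forall x, normc (f x) <= c) -> normc (cint L f) <= c * mass L.
Proof.
move=> hf fc; rewrite (le_trans (normc_sum _ _ _))// /mass big_distrr /=.
apply: ler_sum => k _; rewrite normcM mulrCA ler_wpM2l ?normc_ge0//.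
have fm : (fcm_part k setT)%E \is a fin_num by rewrite fin_num_measure.
rewrite -lee_fin (le_trans (cintegral_normc _ hf))// mulrCA EFinM lee_pmul2l//.
rewrite EFinM fineK// -integral_cst//; apply: ge0_le_integral => //.
- by move=> x _; rewrite lee_fin normc_ge0.
- by apply/measurable_EFinP; exact: cbm_measurable_normc.
- by move=> x _; rewrite lee_fin.
Qed.

Lemma cint_ReIm L (f : T -> R[i]) : cbm f -> cint L f =
  cint L (fun x => (complex.Re (f x))%:C%C) +
  'i%C * cint L (fun x => (complex.Im (f x))%:C%C).
Proof.
move=> [f1 f2 [M fM]].
have hR : cbm (fun x => (complex.Re (f x))%:C%C).
  by apply: cbm_real => //; exists M => x; rewrite (le_trans (Re_le_normc _)).
have hI : cbm (fun x => (complex.Im (f x))%:C%C).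
  by apply: cbm_real => //; exists M => x; rewrite (le_trans (Im_le_normc _)).
rewrite -cintZ// -cintD//; last exact: cbmZ.
by congr cint; apply/funext => x; rewrite [LHS]complexE.
Qed.

End mass.

Section radon_on_compact.
Variables (R : realType) (d : nat).
Local Notation V := ('rV[R]_d).
Local Notation E := (Rd R d).
Local Notation C := (R[i]^o).
Implicit Types (nu : radon R d) (A : set V).

Definition radon_on nu A (cA : compact A) : fcm E R := @Fcm _ E R 'I_4
  (fun k => 'i%C ^+ k)
  (fun k => mfrestr (compact_measurable_Rd cA)
     (@radon_locally_finite R d nu k A cA)).

Lemma cint_radon_on nu A (cA : compact A) (f : E -> R[i]) : cbm f ->
  cint (radon_on nu cA) f = restriction nu A f.
Proof. by move=> hf; apply: eq_bigr => k _; congr (_ * _); exact: cintegral_mfrestr. Qed.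

Lemma eq_restriction nu A (f g : V -> C) : (forall x, A x -> f x = g x) ->
  restriction nu A f = restriction nu A g.
Proof.
move=> fg; apply: eq_bigr => k _; congr (_ * (_ +i* _)%C);
  by apply: eq_Rintegral => x /set_mem/fg ->.
Qed.

Lemma eq_restriction_set nu A B (f : V -> C) :
  (forall x, A x <> B x -> f x = 0) -> restriction nu A f = restriction nu B f.
Proof.
move=> f0; apply: eq_bigr => k _; congr (_ * (_ +i* _)%C);
  rewrite Rintegral_mkcond [RHS]Rintegral_mkcond; apply: eq_Rintegral => x _;
  rewrite !patchE; case: ifPn => Ax; case: ifPn => Bx //; rewrite f0// => AB;
  move: Ax Bx; rewrite ?notin_setE ?in_setE AB //.
Qed.

Lemma restriction_indic nu A (mA : measurable (A : set E)) (f : V -> C) :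
  restriction nu A f = restriction nu setT (fun x => f x * (\1_A x)%:C%C).
Proof.
rewrite (@eq_restriction nu A f (fun x => f x * (\1_A x)%:C%C)).
  apply: eq_restriction_set => x Ax; rewrite indicE memNset ?mulr0// => Ax'.
  by apply: Ax; apply/propext; split.
by move=> x Ax; rewrite indicE mem_set// mulr1.
Qed.

Lemma cint_radon_indic nu A (cA : compact A) (F : set V) :
  measurable (F : set E) -> F `<=` A ->
  cint (radon_on nu cA) (fun x => (\1_F x)%:C%C) = radon_value nu F.
Proof.
move=> mF FA; rewrite cint_radon_on; last exact: cbm_indic.
apply: eq_bigr => k _; congr (_ * (_ +i* _)%C) => /=.
  rewrite /Rintegral integral_indic ?setIidl//.
  exact: compact_measurable_Rd.
by rewrite Rintegral_cst ?mul0r//; exact: compact_measurable_Rd.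
Qed.

(** Cut the range of [h] into intervals of length [eta] and replace [h] by the
    left end points. The integral of the resulting step function is a combination
    of values of [nu] on a finite measurable partition, hence bounded by the total
    variation; the error is at most [eta * mass L]. *)
Lemma total_variation_bound nu A (cA : compact A) (M c : R) (h : E -> R) :
  (Defs.total_variation nu A <= M%:E)%E -> measurable_fun setT h -> 0 <= c ->
  (forall x, `|h x| <= c) -> (forall x, ~ A x -> h x = 0) ->
  normc (cint (radon_on nu cA) (fun x => (h x)%:C%C)) <= M * c.
Proof.
move=> tvM mh c0 hc h0; apply/ler_addgt0Pr => e e0.
set L := radon_on nu cA.
have mA := compact_measurable_Rd cA.
pose eta := e / (mass L + 1).
have mass1 : 0 < mass L + 1 by rewrite ltr_wpDl// mass_ge0.
have eta0 : 0 < eta by rewrite divr_gt0.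
pose N := (Num.truncn ((c + c) / eta)).+1.
(* the minimum changes a level only when no value of h reaches it *)
pose a (j : nat) : R := Num.min c (- c + j%:R * eta).
pose F (j : nat) : set E := A `&` h @^-1` `[- c + j%:R * eta, - c + j.+1%:R * eta[.
have mF j : measurable (F j).
  by apply: measurableI => //; rewrite -[X in measurable X]setTI; exact: mh.
have aF j x : F j x -> a j = - c + j%:R * eta.
  move=> [_]; rewrite /= in_itv /= => /andP[h1 _].
  rewrite /a min_r// (le_trans h1)// (le_trans (ler_norm _))//.
have Fx x : A x -> exists2 j : 'I_N, F j x & forall i : nat, F i x -> i = j.
  move=> Ax; have := hc x; rewrite ler_norml => /andP[h1 h2].
  have q0 : 0 <= (h x + c) / eta by apply: divr_ge0; [lra|exact: ltW].
  have tq := truncn_itv q0.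
  have jN : (Num.truncn ((h x + c) / eta) < N)%N.
    by rewrite ltnS; apply: le_truncn; rewrite ler_pM2r ?invr_gt0// lerD2r.
  have FP (i : nat) : F i x <-> (i%:R <= (h x + c) / eta < i.+1%:R).
    rewrite /F /= in_itv /= ler_pdivlMr// ltr_pdivrMr//.
    split => [[_ /andP[u v]]|/andP[u v]]; first by apply/andP; split; lra.
    by split => //; apply/andP; split; lra.
  exists (Ordinal jN); first by apply/(FP (Num.truncn _)).
  by move=> i /FP /truncn_def <-.
pose S (x : E) : R[i] := \sum_(j < N) (a j)%:C%C * (\1_(F j) x)%:C%C.
have cS (j : 'I_N) : cbm (fun x => (a j)%:C%C * (\1_(F j) x)%:C%C).
  by apply: cbmZ; exact: cbm_indic.
have hS : cbm S by exact: cbm_sum.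
have hh : cbm (fun x => (h x)%:C%C) by apply: cbm_real => //; exists c.
have dS x : normc ((h x)%:C%C - S x) <= eta.
  have [Ax|nAx] := pselect (A x); last first.
    rewrite h0// /S big1 ?subrr ?normc0 ?ltW// => j _.
    by rewrite indicE memNset ?mulr0// => -[].
  have [j Fjx jU] := Fx x Ax.
  rewrite /S (bigD1 j)//= big1 ?addr0 => [|i ij]; last first.
    rewrite indicE memNset ?mulr0// => /jU /val_inj ij'.
    by move: ij; rewrite ij' eqxx.
  rewrite indicE mem_set// mulr1 -rmorphB normc_real (aF _ _ Fjx).
  case: Fjx => _; rewrite /= in_itv /= => /andP[h1 h2].
  rewrite ger0_norm ?subr_ge0// lerBlDl ltW// (lt_le_trans h2)//.
  by rewrite -addrA lerD2l -natr1 mulrDl mul1r.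
have -> : cint L (fun x => (h x)%:C%C) =
    cint L (fun x => (h x)%:C%C - S x) + cint L S by rewrite cintB// subrK.
rewrite (le_trans (le_normcD _ _))// addrC lerD//; last first.
  rewrite (le_trans (cint_le_mass L (cbmB hh hS) dS))// /eta mulrAC.
  by rewrite ler_pdivrMr// ler_pM2l// lerDl.
rewrite /S cint_sum// (le_trans (normc_sum _ _ _))//.
have val (j : 'I_N) : cint L (fun x => (a j)%:C%C * (\1_(F j) x)%:C%C) =
    (a j)%:C%C * radon_value nu (F j).
  by rewrite cintZ ?cint_radon_indic//; [move=> x []|exact: cbm_indic].
under eq_bigr do rewrite val normcM normc_real.
apply: (@le_trans _ _ (c * \sum_(j < N) normc (radon_value nu (F j)))).
  rewrite big_distrr; apply: ler_sum => j _; rewrite ler_wpM2r ?normc_ge0//.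
  rewrite ler_norml /a ge_min lexx orTb andbT le_min; apply/andP; split; first lra.
  by rewrite lerDl mulr_ge0// ltW.
rewrite mulrC ler_wpM2r// -lee_fin (le_trans _ tvM)//.
apply: ereal_sup_ubound; exists N, (fun j : 'I_N => F j); split => //.
- apply/trivIsetP => i j _ _ ij; apply/seteqP; split => // x [Fi Fj].
  have [k _ kU] := Fx x Fi.1.
  by move: ij; rewrite (val_inj (etrans (kU _ Fi) (esym (kU _ Fj)))) eqxx.
- apply/seteqP; split => [x [j _ []]//|x Ax].
  by have [j Fj _] := Fx x Ax; exists j.
Qed.

End radon_on_compact.

(** * Local bounds and averaging kernels *)

Section local_bound.
Variables (R : realType) (d : nat).
Local Notation V := ('rV[R]_d).
Local Notation E := (Rd R d).
Local Notation C := (R[i]^o).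
Local Notation vol := (@lebesgue_Rd R d).
Implicit Types (nu : radon R d) (A : set V) (L N : fcm E R).

(** Translation boundedness at the fixed scale [r], in the only form in which it
    is used. Unlike a bound on the total variation it passes to restrictions,
    differences and conjugates at once. *)
Definition local_bound L (r M : R) := forall (f : E -> R[i]) (w : V) (c : R),
  cbm f -> 0 <= c -> (forall x, normc (f x) <= c) ->
  (forall x, ~ cube w r x -> f x = 0) -> normc (cint L f) <= M * c.

Lemma local_bound_sub L N r M M' : local_bound L r M -> local_bound N r M' ->
  local_bound (fcm_sub L N) r (M + M').
Proof.
move=> hL hN f w c hf c0 fc f0; rewrite cint_sub (le_trans (le_normcB _ _))//.
by rewrite mulrDl lerD//; [exact: (hL f w)|exact: (hN f w)].
Qed.

Lemma local_bound_conj L r M : local_bound L r M -> local_bound (fcm_conj L) r M.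
Proof.
move=> hL f w c hf c0 fc f0; rewrite cint_conj// normcJ; apply: (hL _ w) => //.
- exact: cbmJ.
- by move=> x; rewrite normcJ.
- by move=> x /f0 ->; rewrite conjc0.
Qed.

(** The cube around [w] fits into a translate of [K]. The factor 2 separates real
    and imaginary parts. *)
Lemma radon_local_bound nu (K : set V) (M r : R) (a : V) A (cA : compact A) :
  compact K -> cube a r `<=` K -> (norm_on K nu <= M%:E)%E ->
  local_bound (radon_on nu cA) r (2 * M).
Proof.
move=> cK aK nuM f w c hf c0 fc f0.
pose T := [set (w - a) + x | x in K].
have cT : compact T.
  apply: continuous_compact => //; apply: continuous_subspaceT => x.
  apply: (cvgD (cvg_cst (w - a)) cvg_id); exact: (nbhs_filter x).
have mA := compact_measurable_Rd cA.
have hfA : cbm (fun x => f x * (\1_A x)%:C%C) by apply: cbmM => //; exact: cbm_indic.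
have fT x : ~ T x -> f x = 0.
  move=> nT; apply: f0 => xw; apply: nT; exists (x - (w - a)); last by rewrite addrC subrK.
  by apply: aK; rewrite /cube /= opprB addrA addrAC addrK.
have tvT : (Defs.total_variation nu T <= M%:E)%E.
  by apply: le_trans nuM; apply: ereal_sup_ubound; exists (w - a).
have -> : cint (radon_on nu cA) f = cint (radon_on nu cT) (fun x => f x * (\1_A x)%:C%C).
  rewrite !cint_radon_on// restriction_indic//; apply: eq_restriction_set => x Tx.
  by rewrite fT ?mul0r// => Tx'; apply: Tx; apply/propext; split.
have fA1 x : normc (f x * (\1_A x)%:C%C) <= c.
  rewrite normcM normc_real indicE; case: (_ \in _).
    by rewrite normr1 mulr1.
  by rewrite normr0 mulr0.
rewrite cint_ReIm// (le_trans (le_normcD _ _))// normcM /= expr0n /= add0r.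
rewrite expr1n sqrtr1 mul1r -mulrA mulr_natl mulr2n lerD//.
- apply: total_variation_bound => //; first by case: hfA.
    by move=> x; rewrite (le_trans (Re_le_normc _)).
  by move=> x /fT ->; rewrite mul0r.
- apply: total_variation_bound => //; first by case: hfA.
    by move=> x; rewrite (le_trans (Im_le_normc _)).
  by move=> x /fT ->; rewrite mul0r.
Qed.

Definition carried L A := forall f g : E -> R[i], cbm f -> cbm g ->
  (forall x, A x -> f x = g x) -> cint L f = cint L g.

Lemma carried_radon_on nu A (cA : compact A) : carried (radon_on nu cA) A.
Proof. by move=> f g hf hg fg; rewrite !cint_radon_on//; exact: eq_restriction. Qed.

Lemma carried_sub L N A : carried L A -> carried N A -> carried (fcm_sub L N) A.
Proof.
by move=> hL hN f g hf hg fg; rewrite !cint_sub (hL f g)// (hN f g).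
Qed.

Lemma carried_conj L A : carried L A -> carried (fcm_conj L) A.
Proof.
move=> hL f g hf hg fg; rewrite !cint_conj//; congr conjc; apply: hL.
- exact: cbmJ.
- exact: cbmJ.
- by move=> x /fg ->.
Qed.

(** Lebesgue measure on a compact set as a member of the same family, so that
    averages over cubes are exchanged with other integrals by [cint_fubini]. *)
Definition vol_on A (cA : compact A) : fcm E R :=
  fcm_pos (mfrestr (compact_measurable_Rd cA) (vol_compact cA)).

Lemma cint_vol_on_le A (cA : compact A) (f : E -> R[i]) : cbm f ->
  ((normc (cint (vol_on cA) f))%:E <= 2%:E * \int[vol]_(x in A) (normc (f x))%:E)%E.
Proof.
move=> hf; rewrite cint_pos (le_trans (cintegral_normc _ hf))// integral_mfrestr//.
  exact: cbm_measurable_normc.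
by case: hf => _ _ [M fM]; exists M => x; rewrite ger0_norm ?normc_ge0.
Qed.

Lemma cint_vol_on_bound A (cA : compact A) (f : E -> R[i]) (c : R) : cbm f ->
  (forall x, normc (f x) <= c) ->
  normc (cint (vol_on cA) f) <= c * (2 * fine (vol A)).
Proof.
move=> hf fc; rewrite (le_trans (cint_le_mass _ hf fc))//.
rewrite /mass (bigD1 tt)//= big_pred0; last by case.
by rewrite addr0 expr1n expr0n/= addr0 sqrtr1 mul1r /mfrestr /mrestr setTI.
Qed.

Definition bump (delta : R) (x : E) : R[i] :=
  (((delta *+ 2) ^+ d)^-1 * \1_(cube 0 delta) x)%:C%C.

Lemma bump_height_gt0 (delta : R) : 0 < delta -> 0 < ((delta *+ 2) ^+ d)^-1.
Proof. by move=> d0; rewrite invr_gt0 exprn_gt0// pmulrn_lgt0. Qed.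

Lemma cbm_bump delta : cbm (bump delta).
Proof.
rewrite /bump; under eq_fun do rewrite rmorphM.
by apply: cbmZ; apply: cbm_indic; exact: measurable_cube.
Qed.

Lemma normc_bump delta x : 0 < delta -> normc (bump delta x) <= ((delta *+ 2) ^+ d)^-1.
Proof.
move=> d0; rewrite normc_real ger0_norm ?mulr_ge0// ?(ltW (bump_height_gt0 d0))//.
by rewrite ler_piMr ?(ltW (bump_height_gt0 d0))// indicE; case: (_ \in _).
Qed.

Lemma bump_out delta (x : V) : ~ cube 0 delta x -> bump delta x = 0.
Proof. by move=> nx; rewrite /bump indicE memNset// mulr0. Qed.

Lemma bump_shift delta (t : V) : (fun w : E => bump delta ((w : V) - t)) =
  (fun w => ((((delta *+ 2) ^+ d)^-1)%:C%C * (\1_(cube t delta) w)%:C%C)).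
Proof.
apply/funext => w; rewrite /bump rmorphM; congr (_ * _%:C%C).
by rewrite !indicE; congr ((nat_of_bool _)%:R); apply/idP/idP => /set_mem h; apply/mem_set;
  move: h; rewrite /cube /= subr0.
Qed.

Lemma integral_bump delta (t : V) A : 0 < delta -> measurable (A : set E) ->
  cube t delta `<=` A ->
  (\int[vol]_(w in A) (normc (bump delta ((w : V) - t)))%:E = 1)%E.
Proof.
move=> d0 mA tA.
have e0 := bump_height_gt0 d0.
under eq_integral => w _.
  rewrite (congr1 (fun F => F w) (bump_shift delta t)) normcM !normc_real.
  rewrite (gtr0_norm e0) (ger0_norm (x := \1_(cube t delta) w))// EFinM.
  over.
have mc : measurable (cube t delta : set E) by exact: measurable_cube.
rewrite ge0_integralZl//; last 2 first.
- by apply/measurable_EFinP; exact: measurable_indic.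
- by rewrite lee_fin ltW.
rewrite integral_indic//= setIidl// vol_cube ?ltW// -EFinM mulVf//.
by rewrite -invr_eq0 gt_eqF.
Qed.

Lemma cint_bump delta (t : V) A (cA : compact A) : 0 < delta ->
  cube t delta `<=` A ->
  cint (vol_on cA) (fun w : E => bump delta ((w : V) - t)) = 1.
Proof.
move=> d0 tA; rewrite bump_shift.
have mc : measurable (cube t delta : set E) by exact: measurable_cube.
have hi := cbm_indic (R := R) mc.
rewrite cintZ// cint_pos cintegral_mfrestr//= Rintegral_cst; last exact: compact_measurable_Rd.
rewrite mul0r /Rintegral integral_indic//; last exact: compact_measurable_Rd.
rewrite /= setIidl// vol_cube ?ltW//= -rmorphM mulVf//.
by rewrite -invr_eq0 gt_eqF// bump_height_gt0.
Qed.

End local_bound.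

(** * Smearing: from locally bounded measures to Lebesgue measure *)

Section smearing.
Variables (R : realType) (d : nat).
Local Notation V := ('rV[R]_d).
Local Notation E := (Rd R d).
Local Notation C := (R[i]^o).
Local Notation vol := (@lebesgue_Rd R d).
Implicit Types (A : set V) (L N : fcm E R).

Lemma measurable_diff_pair : measurable_fun setT (fun z : E * E => (z.1 : V) - z.2 : E).
Proof. by apply: measurable_subRd. Qed.

Lemma measurable_subr (w : V) : measurable_fun setT (fun t : E => (w : V) - t : E).
Proof. by apply: measurable_subRd => //; exact: measurable_cst. Qed.

Lemma measurable_addr (w : V) : measurable_fun setT (fun t : E => (w : V) + t : E).
Proof. by apply: measurable_addRd => //; exact: measurable_cst. Qed.

Lemma measurable_subl (w : V) : measurable_fun setT (fun t : E => (t : V) - w : E).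
Proof. by apply: measurable_subRd => //; exact: measurable_cst. Qed.

(** Fubini for the averaging kernel: averages of [G] over the cubes around the
    points [x + t] become a Lebesgue integral of [G], weighted by the [L]-integral
    of [f] over small cubes. *)
Lemma smear L (x : V) W (cW : compact W) (delta : R) (f : E -> R[i]) (G : E -> R[i]) :
  cbm f -> cbm G ->
  cint L (fun t => f t * cint (vol_on cW) (fun w : E => bump delta ((w : V) - (x + t)) * G w)) =
  cint (vol_on cW) (fun w : E => G w * cint L (fun t : E => bump delta ((w : V) - (x + t)) * f t)).
Proof.
move=> hf hG.
pose F (z : E * E) : R[i] := f z.1 * (bump delta ((z.2 : V) - (x + z.1)) * G z.2).
have hb : cbm (fun z : E * E => bump delta ((z.2 : V) - (x + z.1)) : R[i]).
  apply: (cbm_comp (h := fun z : E * E => (z.2 : V) - (x + z.1) : E)); last exact: cbm_bump.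
  apply: measurable_subRd => //; apply: measurable_addRd => //; exact: measurable_cst.
have hF : cbm F.
  apply: cbmM; first exact: (cbm_comp (f := f)).
  by apply: cbmM => //; exact: (cbm_comp (f := G)).
transitivity (cint L (fun t => cint (vol_on cW) (fun w => F (t, w)))).
  congr cint; apply/funext => t; rewrite -cintZ//.
  by apply: cbmM => //; exact: (cbm_pair1 hb).
rewrite cint_fubini//; congr cint; apply/funext => w.
rewrite -cintZ; last by apply: cbmM => //; exact: (cbm_pair2 hb).
by congr cint; apply/funext => t; rewrite /F /=; ring.
Qed.

(** Average a function constant in [w] (the case [G = 1] of [smear] at scale [r]):
    [cint L f] is the average of its localisations to cubes of size [r], each of
    which is controlled by the local bound. This replaces counting the translates
    of a cube that are needed to cover [A]. *)
Lemma local_bound_vol L (r M : R) A W (cW : compact W) (f : E -> R[i]) (c : R) :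
  0 < r -> local_bound L r M ->
  cbm f -> 0 <= c -> (forall x, normc (f x) <= c) -> (forall x, ~ A x -> f x = 0) ->
  (forall t, A t -> cube t r `<=` W) ->
  normc (cint L f) <= M * (((r *+ 2) ^+ d)^-1 * c) * (2 * fine (vol W)).
Proof.
move=> r0 hL hf c0 fc f0 AW.
have -> : cint L f = cint (vol_on cW) (fun w : E =>
    1 * cint L (fun t : E => bump r ((w : V) - (0 + t)) * f t)).
  rewrite -(smear L 0)//; last exact: cbm_cst.
  congr cint; apply/funext => t; have [At|nAt] := pselect (A t); last first.
    by rewrite f0// mul0r.
  under [X in cint _ X]eq_fun do rewrite mulr1 add0r.
  by rewrite cint_bump ?mulr1//; exact: AW.
have e0 := bump_height_gt0 d r0.
apply: cint_vol_on_bound => [|w].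
  pose F (z : E * E) : R[i] := bump r ((z.1 : V) - (0 + z.2)) * f z.2.
  apply: cbmZ; apply: (@cbm_cint _ _ _ _ _ _ F); apply: cbmM.
    apply: (cbm_comp (h := fun z : E * E => (z.1 : V) - (0 + z.2) : E)); last exact: cbm_bump.
    apply: measurable_subRd => //; apply: measurable_addRd => //; exact: measurable_cst.
  exact: (cbm_comp (f := f)).
rewrite mul1r; apply: (hL _ w).
- apply: cbmM => //; apply: (cbm_comp (h := fun t : E => (w : V) - (0 + t) : E));
    last exact: cbm_bump.
  apply: measurable_subRd; [exact: measurable_cst|exact: measurable_addr].
- by rewrite mulr_ge0// ltW.
- by move=> t; rewrite normcM ler_pM ?normc_ge0// normc_bump.
- move=> t nt; rewrite bump_out ?mul0r//; apply: contra_not nt.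
  by rewrite /cube /= subr0 add0r distrC.
Qed.

Section main_estimate.
Variables (L N : fcm E R) (A : set V) (cA : compact A).
Variables (r M M' : R).
Hypotheses (r0 : 0 < r) (M0 : 0 <= M) (M'0 : 0 <= M').
Hypotheses (hL : local_bound L r M) (hN : local_bound N r M') (LA : carried L A).
Variables (g : V -> C) (rho : R).
Hypotheses (Cg : Cc g) (rho0 : 0 < rho) (g0 : forall x, rho < `|x| -> g x = 0).

Let hg : cbm (g : E -> R[i]). Proof. exact: Cc_cbm. Qed.

(** The convolution of [N] with [g]. *)
Definition fcm_conv N : E -> R[i] := fun w : V => cint N (fun s : V => g (w - s)).

Let G := fcm_conv N.

Lemma cbm_conv : cbm G.
Proof.
apply: (@cbm_cint _ _ _ _ _ _ (fun z : E * E => g ((z.1 : V) - z.2))).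
exact: (cbm_comp measurable_diff_pair hg).
Qed.

Lemma cbm_translate (w : V) : cbm (fun s : E => g (w - (s : V))).
Proof. exact: (cbm_comp (measurable_subr w) hg). Qed.

(** What [local_bound_vol] gives for a function bounded by [c] and supported in a
    cube of size [rho + r]; the second [r] is the enlargement due to smearing. *)
Definition conv_const (c : R) :=
  M' * (((r *+ 2) ^+ d)^-1 * c) * (2 * (((rho + r + r) *+ 2) ^+ d)).

Lemma conv_constE (c : R) (w : V) : conv_const c =
  M' * (((r *+ 2) ^+ d)^-1 * c) * (2 * fine (vol (cube w (rho + r + r) : set E))).
Proof. by rewrite vol_cube// !addr_ge0// ltW. Qed.

Lemma conv_const_ge0 (c : R) : 0 <= c -> 0 <= conv_const c.
Proof.
move=> c0; have p (z : R) : 0 <= z -> 0 <= (z *+ 2) ^+ d.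
  by move=> z0; rewrite exprn_ge0// mulrn_wge0.
have rr : 0 <= r by exact: ltW.
have rhor : 0 <= rho + r + r by rewrite !addr_ge0// ltW.
by rewrite /conv_const !mulr_ge0 ?invr_ge0 ?p.
Qed.

Lemma conv_bound (c : R) (w : V) : 0 <= c -> (forall x, normc (g x) <= c) ->
  normc (G w) <= conv_const c.
Proof.
move=> c0 gc.
rewrite (conv_constE _ w); apply: (@local_bound_vol N r M' (cube w (rho + r)) _
  (@compact_cube R d w (rho + r + r))) => //.
- exact: cbm_translate.
- move=> s nws; apply: g0; rewrite ltNge; apply/negP => ws; apply: nws.
  by rewrite /cube /= distrC (le_trans ws)// lerDl ltW.
- move=> t; rewrite /cube /= => tw v /= vt; rewrite -(subrKA t) addrC.
  by rewrite (le_trans (ler_normD _ _))// lerD.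
Qed.

(** As a function of [s], [g (u - s) - g (v - s)] is at most [e] and supported in
    the cube of size [rho + r] around [u]. *)
Lemma conv_unif (delta e : R) (u v : V) : delta <= r -> 0 <= e ->
  (forall u v, `|u - v| <= delta -> normc (g u - g v) <= e) ->
  `|u - v| <= delta -> normc (G u - G v) <= conv_const e.
Proof.
move=> dr e0 ge uv; rewrite /G /fcm_conv -cintB; try exact: cbm_translate.
rewrite (conv_constE _ u); apply: (@local_bound_vol N r M' (cube u (rho + r)) _
  (@compact_cube R d u (rho + r + r))) => //.
- by apply: cbmB; exact: cbm_translate.
- by move=> s; apply: ge; rewrite opprB addrA subrK.
- move=> s nus; rewrite !g0 ?subrr// ltNge; apply/negP => us; apply: nus; rewrite /cube /= distrC.
    have := ler_normD (v - s) (u - v); rewrite addrC subrKA; lra.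
  by rewrite (le_trans us)// lerDl ltW.
- move=> t; rewrite /cube /= => tw w /= vt; rewrite -(subrKA t) addrC.
  by rewrite (le_trans (ler_normD _ _))// lerD.
Qed.

(** The key estimate. The first term is the Lebesgue integral of [G] against the
    [L]-mass of [delta]-cubes, the second the cost of replacing [G (x + t)] by
    its average [S t]. The first has a constant that grows as [delta] shrinks, the
    second a constant independent of [delta] apart from the modulus [e]. *)
Lemma pairing_estimate (x : V) (delta e I : R) (W W' : set V) (cW : compact W) (cW' : compact W') :
  0 < delta -> delta <= r -> 0 <= e ->
  (forall u v, `|u - v| <= delta -> normc (g u - g v) <= e) ->
  (forall t, A t -> cube (x + t) delta `<=` W) ->
  (forall t, A t -> cube t r `<=` W') ->
  (\int[vol]_(w in W) (normc (G w))%:E <= I%:E)%E ->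
  normc (cint L (fun t : E => G (x + (t : V)))) <=
    2 * (M * ((delta *+ 2) ^+ d)^-1) * I +
    M * (((r *+ 2) ^+ d)^-1 * (2 * conv_const e)) * (2 * fine (vol W')).
Proof.
move=> d0 dr e0 ge AW AW' GI.
have mA := compact_measurable_Rd cA.
have cI : cbm (fun t : E => (\1_A t)%:C%C : R[i]) by exact: cbm_indic.
have cG := cbm_conv.
pose S (t : E) : R[i] := cint (vol_on cW) (fun w : E => bump delta ((w : V) - (x + t)) * G w).
have cS : cbm S.
  apply: (@cbm_cint _ _ _ _ _ _ (fun z : E * E => bump delta ((z.2 : V) - (x + z.1)) * G z.2)).
  apply: cbmM; last exact: (cbm_comp (f := G)).
  apply: (cbm_comp (h := fun z : E * E => (z.2 : V) - (x + z.1) : E)); last exact: cbm_bump.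
  apply: measurable_subRd => //; apply: measurable_addRd => //; exact: measurable_cst.
have cGx : cbm (fun t : E => G (x + (t : V))) by exact: (cbm_comp (measurable_addr x) cG).
have -> : cint L (fun t : E => G (x + (t : V))) =
    cint L (fun t => (\1_A t)%:C%C * S t) +
    cint L (fun t => (\1_A t)%:C%C * (G (x + (t : V)) - S t)).
  rewrite -cintD; [|exact: cbmM|by apply: cbmM => //; exact: cbmB].
  apply: LA => //; first by apply: cbmD; apply: cbmM => //; exact: cbmB.
  by move=> t At; rewrite indicE mem_set// !mul1r [RHS]addrC subrK.
have I0 : 0 <= I.
  rewrite -lee_fin (le_trans _ GI)//; apply: integral_ge0 => w _.
  by rewrite lee_fin normc_ge0.
have bd := bump_height_gt0 d d0.
rewrite (le_trans (le_normcD _ _))// lerD//.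
  rewrite /S (smear L x)//.
  pose J (w : E) : R[i] := cint L (fun t : E => bump delta ((w : V) - (x + t)) * (\1_A t)%:C%C).
  have cJ : cbm J.
    apply: (@cbm_cint _ _ _ _ _ _ 
      (fun z : E * E => bump delta ((z.1 : V) - (x + z.2)) * (\1_A z.2)%:C%C)).
    apply: cbmM; last exact: (cbm_comp (f := fun t : E => (\1_A t)%:C%C)).
    apply: (cbm_comp (h := fun z : E * E => (z.1 : V) - (x + z.2) : E)); last exact: cbm_bump.
    apply: measurable_subRd => //; apply: measurable_addRd => //; exact: measurable_cst.
  have Jb w : normc (J w) <= M * ((delta *+ 2) ^+ d)^-1.
    apply: (hL (w := w - x)).
    - apply: cbmM => //; apply: (cbm_comp (h := fun t : E => (w : V) - (x + t) : E));
        last exact: cbm_bump.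
      apply: measurable_subRd; [exact: measurable_cst|exact: measurable_addr].
    - exact: ltW.
    - move=> t; rewrite normcM -[leRHS]mulr1 ler_pM ?normc_ge0 ?normc_bump//.
      by rewrite normc_real indicE; case: (_ \in _); rewrite ?normr0 ?normr1.
    - move=> t nt; rewrite bump_out ?mul0r//; apply: contra_not nt.
      rewrite /cube /= subr0 opprD addrA distrC => /le_trans; apply.
      exact: dr.
  rewrite -lee_fin (le_trans (cint_vol_on_le cW (cbmM cG cJ)))// -mulrA EFinM.
  rewrite lee_pmul2l// EFinM.
  have mG : measurable_fun (W : set E) (fun w : E => (normc (G w))%:E).
    by apply/measurable_EFinP; apply: measurable_funTS; exact: cbm_measurable_normc.
  apply: (@le_trans _ _ ((M * ((delta *+ 2) ^+ d)^-1)%:E * \int[vol]_(w in W) (normc (G w))%:E)%E).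
    rewrite -ge0_integralZl//; last 3 first.
    - exact: compact_measurable_Rd.
    - by move=> w _; rewrite lee_fin normc_ge0.
    - by rewrite lee_fin mulr_ge0// ltW.
    apply: ge0_le_integral.
    - exact: compact_measurable_Rd.
    - by move=> w _; rewrite lee_fin normc_ge0.
    - apply/measurable_EFinP; apply: measurable_funTS; apply: cbm_measurable_normc.
      exact: cbmM.
    - by apply: measurable_funeM.
    - by move=> w _; rewrite -EFinM lee_fin normcM mulrC ler_wpM2r ?normc_ge0.
  by rewrite lee_wpmul2l// lee_fin mulr_ge0// ltW.
apply: (@local_bound_vol L r M A) => //.
- by apply: cbmM => //; exact: cbmB.
- by rewrite mulr_ge0// conv_const_ge0.
- move=> t; have [At|nAt] := pselect (A t); last first.
    rewrite indicE memNset// mul0r normc0.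
    by rewrite mulr_ge0// conv_const_ge0.
  rewrite indicE mem_set// mul1r.
  have cb : cbm (fun w : E => bump delta ((w : V) - (x + t)) : R[i]).
    exact: (cbm_comp (measurable_subl (x + t)) (@cbm_bump R d delta)).
  have -> : G (x + (t : V)) - S t =
      cint (vol_on cW) (fun w : E => bump delta ((w : V) - (x + t)) * (G (x + (t : V)) - G w)).
    transitivity (cint (vol_on cW) 
      (fun w : E => G (x + (t : V)) * bump delta ((w : V) - (x + t))) - S t).
      by rewrite cintZ// cint_bump ?mulr1//; exact: AW.
    rewrite /S -cintB; [|exact: cbmZ|exact: cbmM].
    by congr cint; apply/funext => w; rewrite mulrBr (mulrC (G _)).
  have cGB : cbm (fun w : E => G (x + (t : V)) - G w).
    by apply: cbmB => //; exact: cbm_cst.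
  rewrite -lee_fin (le_trans (cint_vol_on_le cW (cbmM cb cGB)))// EFinM lee_pmul2l//.
  have mc : measurable (W : set E) by exact: compact_measurable_Rd.
  have lc0 : 0 <= conv_const e.
    exact: conv_const_ge0.
  have mb : measurable_fun (W : set E)
      (fun w : E => (normc (bump delta ((w : V) - (x + t)) : R[i]))%:E).
    by apply/measurable_EFinP; apply: measurable_funTS; exact: (cbm_measurable_normc cb).
  rewrite -[leRHS]mule1 -(integral_bump d0 mc (AW t At)) -ge0_integralZl//.
  apply: ge0_le_integral => //.
  + by move=> w _; rewrite lee_fin normc_ge0.
  + apply/measurable_EFinP; apply: measurable_funTS; apply: cbm_measurable_normc.
    exact: cbmM.
  + exact: measurable_funeM.
  + move=> w _; rewrite -EFinM lee_fin normcM mulrC.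
    have [wt|wt] := pselect (cube 0 delta (w - (x + t))); last first.
      by rewrite bump_out// normc0 !mulr0.
    rewrite ler_wpM2r ?normc_ge0//; apply: (conv_unif (delta := delta)) => //.
    by move: wt; rewrite /cube /= subr0 distrC.
  + by move=> w _; rewrite lee_fin normc_ge0.
- by move=> t nAt; rewrite indicE memNset// mul0r.
Qed.

End main_estimate.
End smearing.

(** * Van Hove boundaries *)

Section van_Hove_estimates.
Variables (R : realType) (d : nat).
Local Notation V := ('rV[R]_d).
Local Notation E := (Rd R d).
Local Notation C := (R[i]^o).
Local Notation vol := (@lebesgue_Rd R d).
Implicit Types (A K : set V) (mu nu : radon R d).

Lemma measurable_van_Hove_boundary K A : compact K -> compact A ->
  measurable (van_Hove_boundary K A : set E).
Proof.
move=> cK cA; apply: measurableU.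
  apply: measurableD; first by apply: closed_measurable_Rd; exact: closed_closure.
  by apply: open_measurable_Rd; exact: open_interior.
apply: measurableI; last exact: compact_measurable_Rd.
by apply: measurable_diffset => //; exact: closed_closure.
Qed.

Lemma vol_van_Hove_boundary K A : compact K -> compact A ->
  (vol (van_Hove_boundary K A) < +oo)%E.
Proof.
move=> cK cA; have mB := measurable_van_Hove_boundary cK cA.
have cS := compact_sumset cA cK.
have cU : compact (sumset A K `|` A) by exact: compactU.
apply: (@le_lt_trans _ _ (vol (sumset A K `|` A))); last exact: vol_compact.
apply: le_measure; rewrite ?inE//; first exact: compact_measurable_Rd.
move=> x [[h _]|[_ h]]; [left|by right].
by rewrite ((closure_id _).1 (compact_closed_Rd cS)).
Qed.

Lemma fine_vol_sumset A K : compact A -> compact K ->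
  fine (vol (sumset A K)) <= fine (vol A) + fine (vol (van_Hove_boundary K A)).
Proof.
move=> cA cK; have mB := measurable_van_Hove_boundary cK cA.
have mA := compact_measurable_Rd cA.
have cS := compact_sumset cA cK.
have fA : vol A \is a fin_num by rewrite ge0_fin_numE// vol_compact.
have fB : vol (van_Hove_boundary K A) \is a fin_num.
  by rewrite ge0_fin_numE// vol_van_Hove_boundary.
rewrite -fineD// fine_le//.
- by rewrite ge0_fin_numE// vol_compact.
- by rewrite fin_numD fA.
rewrite (@le_trans _ _ (vol (A `|` van_Hove_boundary K A)))//; last first.
  exact: measureU2.
apply: le_measure; rewrite ?inE//; [exact: compact_measurable_Rd|exact: measurableU|].
move=> x Sx; have [Ax|nAx] := pselect (A x); first by left.
by right; left; split; [exact: subset_closure|move=> /interior_subset].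
Qed.

Lemma cube_sub_of_notin_boundary A (rho : R) (w : V) :
  A w -> ~ van_Hove_boundary (cube 0 rho) A w -> cube w rho `<=` A.
Proof.
move=> Aw nB v vw; apply: contrapT => nAv; apply: nB; right; split => //.
exists v; first exact: subset_closure.
by exists (v - w); [rewrite /cube /= subr0|rewrite opprB addrC subrK].
Qed.

Section difference.
Variables (mu1 mu2 : radon R d) (g : V -> C) (rho : R).
Hypotheses (Cg : Cc g) (g0 : forall x, rho < `|x| -> g x = 0).

Definition diff_on A (cA : compact A) : fcm E R :=
  fcm_sub (radon_on mu1 cA) (radon_on mu2 cA).

Definition diff_conv : V -> C := convolution_fun (fun f => mu1 f - mu2 f) g.

Lemma conv_diff_on A (cA : compact A) w : cube w rho `<=` A ->
  fcm_conv g (diff_on cA) w = diff_conv w.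
Proof.
move=> wA; have h (mu : radon R d) : cint (radon_on mu cA) (fun s : V => g (w - s)) =
    mu (fun s : V => g (w - s)).
  rewrite cint_radon_on; last exact: cbm_translate.
  apply: eq_restriction_set => s As; apply: g0; rewrite ltNge; apply/negP => ws.
  apply: As; apply/propext; split => // _; apply: wA.
  by rewrite /cube /= distrC.
by rewrite /fcm_conv cint_sub !h.
Qed.

Lemma measurable_diff_conv A : compact A ->
  measurable_fun (A : set E) (fun w : E => normc (diff_conv w)).
Proof.
move=> cA; have cS := compact_sumset cA (@compact_cube R d 0 rho).
apply: (eq_measurable_fun (fun w : E => normc (fcm_conv g (diff_on cS) w))).
  move=> w /set_mem Aw; rewrite conv_diff_on// => v vw.
  exists w => //; exists (v - w); last by rewrite addrC subrK.
  by rewrite /cube /= subr0.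
apply: measurable_funTS; apply: cbm_measurable_normc; exact: cbm_conv.
Qed.

(** Off the boundary of [A] at the scale of the support of [g], a point is either
    deep inside [A], where [N * g] agrees with the convolution of the unrestricted
    measure, or so far from [A] that [N * g] vanishes. The hypothesis relating the
    two convolutions is on moduli so as to cover conjugate measures as well. *)
Lemma integral_conv_le A (N : fcm E R) (W : set V) (c a : R) :
  compact A -> carried N A -> compact W -> 0 <= c ->
  (forall w, normc (fcm_conv g N w) <= c) ->
  (forall w, cube w rho `<=` A -> normc (fcm_conv g N w) = normc (diff_conv w)) ->
  (\int[vol]_(w in A) (normc (diff_conv w))%:E <= a%:E)%E ->
  (\int[vol]_(w in W) (normc (fcm_conv g N w))%:E <=
    (a + c * fine (vol (van_Hove_boundary (cube 0 rho) A)))%:E)%E.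
Proof.
move=> cA NA cW c0 Nc Nd Aa; set B := van_Hove_boundary _ _.
have mB : measurable (B : set E).
  by apply: measurable_van_Hove_boundary => //; exact: compact_cube.
have mA := compact_measurable_Rd cA.
have mW := compact_measurable_Rd cW.
have mAB : measurable (A `\` B : set E) by exact: measurableD.
have cG := cbm_conv N Cg.
have mG : measurable_fun setT (fun w : E => (normc (fcm_conv g N w))%:E).
  by apply/measurable_EFinP; exact: cbm_measurable_normc.
have mGD D : measurable_fun D (fun w : E => (normc (fcm_conv g N w))%:E).
  exact: measurable_funTS.
have G0 w : ~ A w -> ~ B w -> fcm_conv g N w = 0.
  move=> nAw nBw; rewrite -(cint0 N); apply: NA.
  - exact: cbm_translate.
  - exact: cbm_cst.
  move=> s As; apply: g0; rewrite ltNge; apply/negP => ws; apply: nBw; left; split.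
    apply: subset_closure; exists s => //; exists (w - s); last by rewrite addrC subrK.
    by rewrite /cube /= subr0.
  by move=> /interior_subset.
have -> : (\int[vol]_(w in W) (normc (fcm_conv g N w))%:E =
    \int[vol]_(w in W `&` (A `|` B)) (normc (fcm_conv g N w))%:E)%E.
  rewrite integral_mkcond [RHS]integral_mkcond; apply: eq_integral => w _.
  rewrite !patchE; case: ifPn => [/set_mem Ww|/negP nW].
    case: ifPn => // /negP nAB.
    by rewrite G0 ?normc0// => h; apply: nAB; apply/mem_set; split => //; (try by left); right.
  by case: ifPn => // /set_mem[Ww _]; case: nW; exact/mem_set.
have mU : measurable (A `|` B : set E) by exact: measurableU.
apply: (@le_trans _ _ (\int[vol]_(w in (A `\` B) `|` B) (normc (fcm_conv g N w))%:E)%E).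
  apply: ge0_subset_integral => //.
  - exact: measurableI.
  - exact: measurableU.
  - by move=> w _; rewrite lee_fin normc_ge0.
  - by move=> w [_ [Aw|Bw]]; [have [Bw|nBw] := pselect (B w); [right|left]|right].
rewrite ge0_integral_setU//; last 2 first.
- by move=> w _; rewrite lee_fin normc_ge0.
- by apply/disj_setPS => w [[_ nB] /nB].
rewrite EFinD leeD//.
  apply: le_trans Aa.
  rewrite (eq_integral (fun w : E => (normc (diff_conv w))%:E)); last first.
    move=> w /set_mem [Aw nBw]; rewrite Nd//.
    exact: cube_sub_of_notin_boundary.
  apply: ge0_subset_integral => //.
  - by apply/measurable_EFinP; exact: measurable_diff_conv.
  - by move=> w _; rewrite lee_fin normc_ge0.
have fB : vol B \is a fin_num.
  by rewrite ge0_fin_numE// vol_van_Hove_boundary//; exact: compact_cube.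
rewrite EFinM fineK// -integral_cst//; apply: ge0_le_integral => //.
- by move=> w _; rewrite lee_fin normc_ge0.
- by move=> w _; rewrite lee_fin.
Qed.

End difference.

End van_Hove_estimates.

(** * The difference of two autocorrelations on a compact set *)

Section autocorrelation.
Variables (R : realType) (d : nat).
Local Notation V := ('rV[R]_d).
Local Notation E := (Rd R d).
Local Notation C := (R[i]^o).
Local Notation vol := (@lebesgue_Rd R d).
Implicit Types (A K : set V) (mu nu : radon R d) (L : fcm E R).

Definition pairing (g : V -> C) (x : V) L1 L2 : R[i] :=
  cint L1 (fun s : E => cint L2 (fun t : E => g (x - ((s : V) - t)))).

Section pairing.
Variables (g : V -> C) (x : V).
Hypothesis Cg : Cc g.

Let gp (z : E * E) : R[i] := g (x - ((z.1 : V) - z.2)).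

Let cgp : cbm gp.
Proof.
apply: (@cbm_comp _ _ _ _ _ (g : E -> R[i]) (fun z : E * E => x - ((z.1 : V) - z.2) : E)).
  by apply: measurable_subRd; [exact: measurable_cst|exact: measurable_diff_pair].
exact: Cc_cbm.
Qed.

Lemma pairing_subl L1 L1' L2 :
  pairing g x (fcm_sub L1 L1') L2 = pairing g x L1 L2 - pairing g x L1' L2.
Proof. exact: cint_sub. Qed.

Lemma pairing_conj_subr L1 L2 L2' : pairing g x L1 (fcm_conj (fcm_sub L2 L2')) =
  pairing g x L1 (fcm_conj L2) - pairing g x L1 (fcm_conj L2').
Proof.
rewrite /pairing -cintB; [|exact: (cbm_cint _ cgp)|exact: (cbm_cint _ cgp)].
congr cint; apply/funext => s; have cs := cbm_pair1 cgp s.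
by rewrite !(cint_conj _ cs) cint_sub rmorphB.
Qed.

(** The double integral can be read as an integral of a convolution against
    either of the two measures; the difference measure always goes inside. *)
Lemma pairing_convl L1 L2 :
  pairing g x L1 L2 = cint L2 (fun t : E => fcm_conv g L1 (x + (t : V))).
Proof.
rewrite /pairing (cint_fubini _ _ cgp); congr cint; apply/funext => t.
by congr cint; apply/funext => s; rewrite /gp /= opprB addrA addrAC.
Qed.

Lemma pairing_convr L1 L2 : pairing g x L1 L2 =
  cint L1 (fun s : E => fcm_conv (fun y => g (- y)) L2 (- x + (s : V))).
Proof.
congr cint; apply/funext => s; congr cint; apply/funext => t.
by rewrite !opprD !opprK addrA.
Qed.

Lemma convolution_tilde mu A (cA : compact A) :
  convolution (restriction mu A) (tilde (restriction mu A)) (fun y => g (x - y)) =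
  pairing g x (radon_on mu cA) (fcm_conj (radon_on mu cA)).
Proof.
rewrite /pairing cint_radon_on; last exact: (cbm_cint _ cgp).
apply: eq_restriction => s _; have cs := cbm_pair1 cgp s.
rewrite (cint_conj _ cs) cint_radon_on; last exact: cbmJ.
by [].
Qed.

End pairing.

(** Why the conclusion for [g] uses mean convergence for both [g] and
    [tilde_fun g]. *)
Lemma conv_conj (g : V -> C) L w : Cc g ->
  fcm_conv (fun y => g (- y)) (fcm_conj L) w = conjc (fcm_conv (tilde_fun g) L w).
Proof.
move=> Cg; rewrite /fcm_conv cint_conj; last first.
  exact: (cbm_translate (Cc_opp Cg) w).
by [].
Qed.

Section finite_volume.
Variables (mu1 mu2 : radon R d) (r M : R) (g : V -> C) (rho c delta e : R).
Hypotheses (r0 : 0 < r) (M0 : 0 <= M).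
Hypothesis b1 : forall A (cA : compact A), local_bound (radon_on mu1 cA) r M.
Hypothesis b2 : forall A (cA : compact A), local_bound (radon_on mu2 cA) r M.
Hypotheses (Cg : Cc g) (rho0 : 0 < rho) (g0 : forall x, rho < `|x| -> g x = 0).
Hypotheses (c0 : 0 <= c) (gc : forall x, normc (g x) <= c).
Hypotheses (d0 : 0 < delta) (dr : delta <= r) (e0 : 0 <= e).
Hypothesis ge : forall u v, `|u - v| <= delta -> normc (g u - g v) <= e.
Variables (A : set V) (cA : compact A) (a a' : R).
Hypothesis ha : (\int[vol]_(w in A) (normc (diff_conv mu1 mu2 g w))%:E <= a%:E)%E.
Hypothesis ha' :
  (\int[vol]_(w in A) (normc (diff_conv mu1 mu2 (tilde_fun g) w))%:E <= a'%:E)%E.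

Let autocorr mu x :=
  convolution (restriction mu A) (tilde (restriction mu A)) (fun y => g (x - y)).
Let bd := fine (vol (van_Hove_boundary (cube 0 rho) A)).
Let cst := conv_const d r (M + M) rho c.
Let err := M * (((r *+ 2) ^+ d)^-1 * (2 * conv_const d r (M + M) rho e)) *
  (2 * (fine (vol A) + fine (vol (van_Hove_boundary (cube 0 r) A)))).

(** With [P1], [P2] the restrictions of the two measures and [N = P1 - P2], and
    with a bar for conjugation, [P1 x bar P1 - P2 x bar P2] equals
    [N x bar P1 + P2 x bar N]; both terms fall under [pairing_estimate]. *)
Lemma autocorr_diff_le x : normc (autocorr mu1 x - autocorr mu2 x) <=
  (2 * (M / (delta *+ 2) ^+ d) * (a + cst * bd) + err) +
  (2 * (M / (delta *+ 2) ^+ d) * (a' + cst * bd) + err).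
Proof.
pose P1 := radon_on mu1 cA; pose P2 := radon_on mu2 cA.
pose N : fcm E R := diff_on mu1 mu2 cA.
have M20 : 0 <= M + M by rewrite addr_ge0.
have bN : local_bound N r (M + M) by apply: local_bound_sub; [exact: b1|exact: b2].
have kN : carried N A by apply: carried_sub; exact: carried_radon_on.
have Ct : Cc (tilde_fun g) by exact: Cc_tilde.
have Co : Cc (fun y => g (- y)) by exact: Cc_opp.
have t0 x' : rho < `|x'| -> tilde_fun g x' = 0.
  by move=> xr; rewrite /tilde_fun g0 ?normrN// conjc0.
have tc x' : normc (tilde_fun g x') <= c by rewrite /tilde_fun normcJ.
have o0 x' : rho < `|x'| -> g (- x') = 0 by move=> xr; rewrite g0// normrN.
have oe u v : `|u - v| <= delta -> normc (g (- u) - g (- v)) <= e.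
  by move=> uv; apply: ge; rewrite opprK addrC distrC.
have cr := @compact_cube R d 0 r.
have cS := compact_sumset cA cr.
have AS t : A t -> cube t r `<=` sumset A (cube 0 r).
  move=> At v tv; exists t => //; exists (v - t); last by rewrite addrC subrK.
  by rewrite /cube /= subr0.
have AW y t : A t -> cube (y + t) delta `<=` sumset A (cube y delta).
  move=> At v tv; exists t => //; exists (v - t); last by rewrite addrC subrK.
  by move: tv; rewrite /cube /= opprD addrA addrAC.
have cst0 : 0 <= cst by exact: conv_const_ge0.
have main L L' (h : V -> C) (b : R) y :
    local_bound L r M -> carried L A -> local_bound L' r (M + M) ->
    Cc h -> (forall x, rho < `|x| -> h x = 0) ->
    (forall u v, `|u - v| <= delta -> normc (h u - h v) <= e) ->
    (\int[vol]_(w in sumset A (cube y delta)) (normc (fcm_conv h L' w))%:E <=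
      (b + cst * bd)%:E)%E ->
    normc (cint L (fun t : E => fcm_conv h L' (y + (t : V)))) <=
      2 * (M / (delta *+ 2) ^+ d) * (b + cst * bd) + err.
  move=> hL kL hL' Ch h0 he hI.
  have cW := compact_sumset cA (@compact_cube R d y delta).
  apply: le_trans (pairing_estimate cA r0 M0 M20 hL hL' kL Ch rho0 h0 cW cS
    d0 dr e0 he (@AW y) AS hI) _.
  rewrite lerD2l /err ler_wpM2l//.
apply: mulr_ge0 => //; apply: mulr_ge0; first exact/ltW/bump_height_gt0.
    by apply: mulr_ge0 => //; exact: conv_const_ge0.
  by rewrite ler_wpM2l// fine_vol_sumset.
have -> : autocorr mu1 x - autocorr mu2 x =
    pairing g x N (fcm_conj P1) + pairing g x P2 (fcm_conj N).
  rewrite /autocorr !(convolution_tilde _ Cg _ cA) pairing_subl pairing_conj_subr//.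
  by rewrite addrA subrK.
rewrite (le_trans (le_normcD _ _))// lerD//.
  rewrite pairing_convl//; apply: main => //.
  - by apply: local_bound_conj; exact: b1.
  - by apply: carried_conj; exact: carried_radon_on.
  apply: (integral_conv_le (mu1 := mu1) (mu2 := mu2)) => //.
  - by apply: compact_sumset => //; exact: compact_cube.
  - by move=> w; exact: (conv_bound r0 bN Cg rho0 g0).
  - by move=> w wA; rewrite (conv_diff_on _ _ Cg g0).
rewrite pairing_convr; apply: main => //.
- exact: b2.
- exact: carried_radon_on.
- exact: local_bound_conj.
under eq_integral do rewrite conv_conj// normcJ.
apply: (integral_conv_le (mu1 := mu1) (mu2 := mu2)) => //.
- by apply: compact_sumset => //; exact: compact_cube.
- by move=> w; exact: (conv_bound r0 bN Ct rho0 t0).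
- by move=> w wA; rewrite (conv_diff_on _ _ Ct t0).
Qed.

End finite_volume.

End autocorrelation.

(** * Passage to the limit *)

Section limits.
Variable R : realType.

Lemma cvge0_lt (u : nat -> \bar R) (e : R) : u n @[n --> \oo] --> 0%E -> 0 < e ->
  \forall n \near \oo, (u n < e%:E)%E.
Proof.
move=> /fine_cvgP[uf /cvgrPdist_lt/(_ e)] + e0 => /(_ e0).
apply: filterS2 uf => n un; rewrite sub0r normrN => h.
by rewrite -(fineK un) lte_fin (le_lt_trans (ler_norm _)).
Qed.

Lemma cvge0_intro (u : nat -> \bar R) : (forall n, 0 <= u n)%E ->
  (forall e : R, 0 < e -> \forall n \near \oo, (u n <= e%:E)%E) ->
  u n @[n --> \oo] --> 0%E.
Proof.
move=> u0 h; apply/fine_cvgP; split.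
  apply: filterS (h 1 ltr01) => n un.
  by rewrite ge0_fin_numE// (le_lt_trans un)// ltry.
apply/cvgrPdist_le => e e0; apply: filterS (h e e0) => n un.
rewrite sub0r normrN ger0_norm ?fine_ge0//.
by rewrite -lee_fin fineK// ge0_fin_numE// (le_lt_trans un)// ltry.
Qed.

Lemma limn_esup_lt (u : nat -> \bar R) (e : \bar R) : (limn_esup u < e)%E ->
  \forall n \near \oo, (u n < e)%E.
Proof.
move=> /ereal_inf_lt[_ [B oB <-] Be]; apply: filterS oB => n Bn.
by apply: le_lt_trans Be; apply: ereal_sup_ubound; exists n.
Qed.

Lemma normc_lim_le (u v : nat -> R[i]^o) (l l' : R[i]^o) (e : R) :
  u @ \oo --> l -> v @ \oo --> l' ->
  (\forall n \near \oo, normc (u n - v n) <= e) -> normc (l - l') <= e.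
Proof.
move=> ul vl h; apply/ler_addgt0Pr => a a0.
have a2 : 0 < a / 2 by rewrite divr_gt0.
have hu : \forall n \near \oo, normc (l - u n) < a / 2.
  exact: ((cvgC_normc (F := \oo) u l).1 ul).
have hv : \forall n \near \oo, normc (l' - v n) < a / 2.
  exact: ((cvgC_normc (F := \oo) v l').1 vl).
have [n [[h1 h2] h3]] := filter_ex (filterI (filterI hu hv) h).
have -> : l - l' = (l - u n) + (u n - v n) - (l' - v n) by ring.
rewrite (le_trans (le_normcB _ _))// (le_trans (lerD (le_normcD _ _) (lexx _)))//.
lra.
Qed.

Lemma ler_div_add1 (a e : R) : 0 <= a -> 0 < e -> a * (e / (a + 1)) <= e.
Proof.
move=> a0 e0; have a1 : 0 < a + 1 by rewrite ltr_wpDl.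
by rewrite mulrA ler_pdivrMr// mulrDr mulr1 mulrC lerDl ltW.
Qed.

End limits.

Section main.
Variables (R : realType) (d : nat).
Local Notation V := ('rV[R]_d).
Local Notation E := (Rd R d).
Local Notation C := (R[i]^o).
Local Notation vol := (@lebesgue_Rd R d).

(** The order of the choices matters: the modulus [e], hence [delta], is fixed by
    [eta] through the constant [k1], which is free of [delta]; only then is [eps]
    chosen, against the constant [k2] that blows up as [delta] tends to zero. *)
Lemma autocorr_diff_small (r M eta : R) (g : V -> C) :
  0 < r -> 0 <= M -> 0 < eta -> Cc g ->
  exists rho eps : R, [/\ 0 < rho, 0 < eps &
    forall (mu1 mu2 : radon R d) (A : set V) (x : V), compact A ->
    (forall B (cB : compact B), local_bound (radon_on mu1 cB) r M) ->
    (forall B (cB : compact B), local_bound (radon_on mu2 cB) r M) ->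
    0 < fine (vol A) ->
    (\int[vol]_(w in A) (normc (diff_conv mu1 mu2 g w))%:E
      <= (eps * fine (vol A))%:E)%E ->
    (\int[vol]_(w in A) (normc (diff_conv mu1 mu2 (tilde_fun g) w))%:E
      <= (eps * fine (vol A))%:E)%E ->
    fine (vol (van_Hove_boundary (cube 0 rho) A)) <= eps * fine (vol A) ->
    fine (vol (van_Hove_boundary (cube 0 r) A)) <= fine (vol A) ->
    normc (convolution (restriction mu1 A) (tilde (restriction mu1 A)) (fun y => g (x - y))
      - convolution (restriction mu2 A) (tilde (restriction mu2 A)) (fun y => g (x - y)))
     <= eta * fine (vol A)].
Proof.
move=> r0 M0 eta0 Cg.
have [rho rho0 g0] := Cc_support Cg.
have [c c0 gc] := Cc_bounded Cg.
have M20 : 0 <= M + M by rewrite addr_ge0.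
pose l1 : R := conv_const d r (M + M) rho 1.
have l10 : 0 <= l1 by exact: conv_const_ge0.
pose q : R := ((r *+ 2) ^+ d)^-1.
have q0 : 0 <= q by exact/ltW/bump_height_gt0.
pose k1 : R := 16 * (M * q * l1).
have k10 : 0 <= k1 by apply: mulr_ge0 => //; rewrite mulr_ge0// mulr_ge0.
have eta2 : 0 < eta / 2 by rewrite divr_gt0.
pose e : R := eta / 2 / (k1 + 1).
have e0 : 0 < e by rewrite divr_gt0// ltr_wpDl.
have [delta1 delta10 gdelta1] := Cc_unif Cg e0.
pose delta := Num.min delta1 r.
have d0 : 0 < delta by rewrite lt_min delta10.
have dr : delta <= r by rewrite ge_min lexx orbT.
have gdelta u v : `|u - v| <= delta -> normc (g u - g v) <= e.
  by move=> uv; apply: gdelta1; rewrite (le_trans uv)// ge_min lexx.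
pose cst := conv_const d r (M + M) rho c.
have cst0 : 0 <= cst by exact: conv_const_ge0.
pose k2 : R := 4 * (M / (delta *+ 2) ^+ d) * (1 + cst).
have k20 : 0 <= k2.
  apply: mulr_ge0; last by rewrite addr_ge0.
  by apply: mulr_ge0 => //; apply: mulr_ge0 => //; exact/ltW/bump_height_gt0.
pose eps : R := eta / 2 / (k2 + 1).
have eps0 : 0 < eps by rewrite divr_gt0// ltr_wpDl.
exists rho, eps; split => // mu1 mu2 A x cA b1 b2 v0 ha ha' hb hb'.
have := autocorr_diff_le r0 M0 b1 b2 Cg rho0 g0 c0 gc d0 dr (ltW e0) gdelta cA ha ha' x.
move=> /le_trans; apply; rewrite -/cst -/q.
set v := fine (vol A) in v0 hb hb' *.
set b := fine _ in hb *; set b' := fine _ in hb' *.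
have -> : conv_const d r (M + M) rho e = e * l1 by rewrite /conv_const /l1 /conv_const; ring.
pose k := M / (delta *+ 2) ^+ d.
have k0 : 0 <= k by apply: mulr_ge0 => //; exact/ltW/bump_height_gt0.
rewrite -/k.
have h1 : k2 * eps <= eta / 2 by exact: ler_div_add1.
have h2 : k1 * e <= eta / 2 by exact: ler_div_add1.
have h3 : k * (cst * b) <= k * (cst * (eps * v)) by rewrite !ler_wpM2l.
have h4 : M * q * l1 * e * b' <= M * q * l1 * e * v.
  by apply: ler_wpM2l => //; rewrite mulr_ge0 ?(ltW e0)// mulr_ge0// mulr_ge0.
have h5 : k2 * eps * v <= eta / 2 * v by rewrite ler_wpM2r// ltW.
have h6 : k1 * e * v <= eta / 2 * v by rewrite ler_wpM2r// ltW.
rewrite /k2 -/k in h5; rewrite /k1 in h6; lra.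
Qed.

Lemma sup_norm_ge0 (h : V -> C) : (0 <= sup_norm h)%E.
Proof.
apply: (@le_trans _ _ (normc (h 0))%:E); first by rewrite lee_fin normc_ge0.
by apply: ereal_sup_ubound; exists 0.
Qed.

(** Half the radius of an open ball inside [K], because cubes are closed balls. *)
Lemma equi_translation_bounded_local (F : set (radon R d)) :
  equi_translation_bounded F -> exists r M : R, [/\ 0 < r, 0 <= M &
    forall mu, F mu -> forall A (cA : compact A), local_bound (radon_on mu cA) r M].
Proof.
move=> [K [cK _ [a] /nbhs_ballP[r /= r0 rK] [M FM]]].
exists (r / 2), (2 * `|M|); split => [||mu /FM muM A cA].
- by rewrite divr_gt0.
- by rewrite mulr_ge0.
apply: (@radon_local_bound _ _ mu K `|M| (r / 2) a) => //.
  move=> v va; apply: rK; rewrite -ball_normE /ball_ /= distrC.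
  by rewrite (le_lt_trans va)// ltr_pdivrMr// ltr_pMr// ltr1n.
by rewrite (le_trans muM)// lee_fin ler_norm.
Qed.

Lemma upper_mean_near (A : nat -> set V) (f : V -> C) (e : R) :
  (upper_mean A f < e%:E)%E ->
  \forall m \near \oo, 0 < fine (vol (A m)) ->
    (\int[vol]_(x in A m) (normc (f x))%:E <= (e * fine (vol (A m)))%:E)%E.
Proof.
move=> /limn_esup_lt; apply: filterS => m h v0.
by move: (ltW h); rewrite lee_pdivrMl// => /le_trans; apply; rewrite -EFinM mulrC.
Qed.

Lemma van_Hove_near (A : nat -> set V) (K : set V) (e : R) : van_Hove A -> compact K ->
  0 < e -> \forall m \near \oo,
    fine (vol (van_Hove_boundary K (A m))) <= e * fine (vol (A m)).
Proof.
move=> [_ _ h] cK e0; have /eqoP/(_ _ e0) := h K cK; apply: filterS => m.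
by rewrite ger0_norm ?fine_ge0// ger0_norm ?fine_ge0.
Qed.

Lemma product_cvg_autocorrelation (A : nat -> set V) (mun : nat -> radon R d)
    (mu : radon R d) (gamman : nat -> radon R d) (gamma : radon R d) :
  van_Hove A -> equi_translation_bounded (range mun `|` [set mu]) ->
  (forall n, is_autocorrelation A (mun n) (gamman n)) ->
  is_autocorrelation A mu gamma ->
  mean_cvg A mun mu -> product_cvg gamman gamma.
Proof.
move=> vH /equi_translation_bounded_local[r [M [r0 M0 bound]]] acn ac mc g Cg.
apply: cvge0_intro => [n|eta eta0]; first exact: sup_norm_ge0.
have [rho [eps [rho0 eps0 small]]] := autocorr_diff_small r0 M0 eta0 Cg.
have := cvge0_lt (mc g Cg) eps0.
have := cvge0_lt (mc _ (Cc_tilde Cg)) eps0.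
apply: filterS2 => n hn' hn.
apply: ge_ereal_sup => _ [x _ <-]; rewrite lee_fin.
have Cx := Cc_comp_shift x Cg.
apply: (normc_lim_le (acn n _ Cx) (ac _ Cx)).
have vb1 := van_Hove_near vH (@compact_cube R d 0 rho) eps0.
have vb2 := van_Hove_near vH (@compact_cube R d 0 r) ltr01.
have i1 := upper_mean_near hn; have i2 := upper_mean_near hn'.
apply: filterS2 (filterI i1 i2) (filterI vb1 vb2) => m [hg hgt] [hrho hr].
rewrite /normalized -mulrBr normcM normc_real.
have v0 : 0 <= fine (vol (A m)) by exact: fine_ge0.
move: v0; rewrite le_eqVlt => /predU1P[<-|v0].
  (* a van Hove sequence may consist of empty sets; then both means are zero *)
  by rewrite invr0 normr0 mul0r ltW.
have vi : 0 <= (fine (vol (A m)))^-1 by rewrite invr_ge0 ltW.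
rewrite (ger0_norm vi) mulrC ler_pdivrMr//.
have cA : compact (A m) by case: vH.
apply: small => //.
- by move=> B cB; apply: bound; left; exists n.
- by move=> B cB; apply: bound; right.
- exact: hg.
- exact: hgt.
- by move: hr; rewrite mul1r.
Qed.

Lemma product_cvg_vague (gamman : nat -> radon R d) (gamma : radon R d) :
  product_cvg gamman gamma -> vague_cvg gamman gamma.
Proof.
move=> h g Cg; apply/cvgC_normc => e e0.
apply: filterS (cvge0_lt (h _ (Cc_opp Cg)) e0) => n hn.
rewrite -normcN opprB -lte_fin; apply: le_lt_trans hn.
apply: ereal_sup_ubound; exists 0 => //; congr (normc _)%:E.
by rewrite /convolution_fun; under eq_fun do rewrite sub0r opprK.
Qed.

End main.

Theorem theorem8p4 (R : realType) (d : nat) (A : nat -> set 'rV[R]_d)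
    (mun : nat -> radon R d) (mu : radon R d)
    (gamman : nat -> radon R d) (gamma : radon R d) :
  van_Hove A ->
  equi_translation_bounded (range mun `|` [set mu]) ->
  (forall n, is_autocorrelation A (mun n) (gamman n)) ->
  is_autocorrelation A mu gamma ->
  (forall n, exists rho : radon R d,
     is_Eberlein_convolution A (mun n) mu rho) ->
  mean_cvg A mun mu ->
  product_cvg gamman gamma /\
  vague_cvg gamman gamma.
Proof.
move=> vH eb acn ac _ mc.
have pc := product_cvg_autocorrelation vH eb acn ac mc.
by split; [|exact: product_cvg_vague].
Qed.
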